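(* Let $\gamma=0.06$, or, if only pairs $(n,m)$ with $n\ge 4m$ and $m\ge 10$ are considered, let $\gamma=0.18$. There is an algorithm which, given a graph $G=(V,E)$ with $n$ vertices and an integer $1<m\le n$, computes in $n^{O(\ln m)}$ time an $m$-subset $S\subset V$ satisfying $$\exp\{\gamma m\,\sigma(S)\}\ \ge\ \frac12\binom nm^{-1}\mathrm{Density}_m(G),$$ where the implicit constant in the ''$O$'' notation is absolute.
   Context: Graphs are undirected, without loops or multiple edges. For a subset $S\subset V$ of the vertex set of $G=(V,E)$ with $|S|\ge 2$, the density of $S$ is $$\sigma(S)=\frac{|\{\{u,v\}\in E:\ u,v\in S\}|}{\binom{|S|}{2}}.$$ For the constant $\gamma>0$ in the claim, the density functional is $$\mathrm{Density}_m(G)=\sum_{\substack{S\subset V\\ |S|=m}} w(S),$$ where, for an $m$-subset $S$ with $\sigma(S)=t$, $$w(S)=e^{\gamma m}\left(1+\frac{\gamma}{m-1}\right)^{(t-1)\binom m2}\left(1-\frac{\gamma}{m-1}\right)^{(1-t)\binom m2}=\exp\left\{\gamma m\,\sigma(S)+O\left(\frac1m\right)\right\}.$$ Time is measured by the number of arithmetic operations. *)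

(* Defs.v *)
From HB Require Import structures.
From mathcomp Require Import all_boot all_order all_algebra.
From mathcomp Require Import reals sequences exp.

Set Implicit Arguments.
Unset Strict Implicit.
Unset Printing Implicit Defensive.

Import Order.TTheory GRing.Theory Num.Theory.
Local Open Scope ring_scope.

(* Graphs and the density functional *)

Record sgraph (n : nat) := SGraph {
  adj :> rel 'I_n;
  adj_sym : symmetric adj;
  adj_irr : irreflexive adj }.

Definition edges n (G : sgraph n) : {set {set 'I_n}} :=
  [set [set p.1; p.2] | p : 'I_n * 'I_n & G p.1 p.2].

Section Density.
Variable R : realType.

Definition sigma n (G : sgraph n) (S : {set 'I_n}) : R :=
  #|[set A in edges G | A \subset S]|%:R / 'C(#|S|, 2)%:R.

(* The exponents are real numbers, hence the use of powR. *)
Definition weight (gamma : R) (m n : nat) (G : sgraph n) (S : {set 'I_n}) : R :=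
  let t := sigma G S in
  expR (gamma * m%:R)
  * (1 + gamma / (m%:R - 1)) `^ ((t - 1) * 'C(m, 2)%:R)
  * (1 - gamma / (m%:R - 1)) `^ ((1 - t) * 'C(m, 2)%:R).

Definition Density (gamma : R) (m n : nat) (G : sgraph n) : R :=
  \sum_(S : {set 'I_n} | #|S| == m) weight gamma m G S.

End Density.

(* Algorithms.  The model is an algebraic random access machine, presented as
   a structured programming language.  The memory consists of arrays of natural
   numbers (indices, counters, combinatorial data) and arrays of exact
   rationals, all unbounded; [s.(imem) a i] is cell i of array number a.
   A program is one finite syntactic object, independent of the input, so the
   algorithms are uniform in the graph, in n and in m.
   The operations are ring operations on indices (with truncated subtraction),
   field operations on rationals, and comparisons.  There is neither rounding
   nor integer division, and a rational cannot be used as an address. *)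

Record store := Store {
  imem : nat -> nat -> nat;
  qmem : nat -> nat -> rat }.

Definition upd (T : Type) (f : nat -> nat -> T) (a i : nat) (v : T) :
    nat -> nat -> T :=
  fun b j => if (b == a) && (j == i) then v else f b j.

Inductive iexp :=
| ICst of nat
| IGet of nat & iexp
| IAdd of iexp & iexp
| ISub of iexp & iexp
| IMul of iexp & iexp.

Inductive qexp :=
| QCst of rat
| QGet of nat & iexp
| QInj of iexp
| QAdd of qexp & qexp
| QSub of qexp & qexp
| QMul of qexp & qexp
| QDiv of qexp & qexp.

Inductive test :=
| ILt of iexp & iexp
| QLt of qexp & qexp
| TNot of test
| TAnd of test & test.

Inductive prog :=
| PSkip
| PISet of nat & iexp & iexp
| PQSet of nat & iexp & qexp
| PSeq of prog & prog
| PIf of test & prog & prog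
| PWhile of test & prog.

Fixpoint ieval (s : store) (e : iexp) : nat :=
  match e with
  | ICst k => k
  | IGet a i => s.(imem) a (ieval s i)
  | IAdd e1 e2 => (ieval s e1 + ieval s e2)%N
  | ISub e1 e2 => (ieval s e1 - ieval s e2)%N
  | IMul e1 e2 => (ieval s e1 * ieval s e2)%N
  end.

Fixpoint qeval (s : store) (e : qexp) : rat :=
  match e with
  | QCst q => q
  | QGet a i => s.(qmem) a (ieval s i)
  | QInj i => (ieval s i)%:R
  | QAdd e1 e2 => qeval s e1 + qeval s e2
  | QSub e1 e2 => qeval s e1 - qeval s e2
  | QMul e1 e2 => qeval s e1 * qeval s e2
  | QDiv e1 e2 => qeval s e1 / qeval s e2
  end.

Fixpoint teval (s : store) (b : test) : bool :=
  match b with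
  | ILt e1 e2 => (ieval s e1 < ieval s e2)%N
  | QLt e1 e2 => qeval s e1 < qeval s e2
  | TNot b1 => ~~ teval s b1
  | TAnd b1 b2 => teval s b1 && teval s b2
  end.

(* Every operation, memory access, constant, comparison and connective
   evaluated costs 1. *)
Fixpoint icost (e : iexp) : nat :=
  match e with
  | ICst _ => 1
  | IGet _ i => (icost i).+1
  | IAdd e1 e2 | ISub e1 e2 | IMul e1 e2 => (icost e1 + icost e2).+1
  end.

Fixpoint qcost (e : qexp) : nat :=
  match e with
  | QCst _ => 1
  | QGet _ i | QInj i => (icost i).+1
  | QAdd e1 e2 | QSub e1 e2 | QMul e1 e2 | QDiv e1 e2 =>
      (qcost e1 + qcost e2).+1
  end.

Fixpoint tcost (b : test) : nat :=
  match b with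
  | ILt e1 e2 => (icost e1 + icost e2).+1
  | QLt e1 e2 => (qcost e1 + qcost e2).+1
  | TNot b1 => (tcost b1).+1
  | TAnd b1 b2 => (tcost b1 + tcost b2).+1
  end.

(* [run c s t s'] : started in s, the program c halts in s' after t steps.
   Control flow is charged too, so t bounds the number of arithmetic
   operations, and no work can be hidden in tests or data movement. *)
Inductive run : prog -> store -> nat -> store -> Prop :=
| run_skip s : run PSkip s 1 s
| run_iset a i e s :
    run (PISet a i e) s (icost i + icost e).+1
      (Store (upd s.(imem) a (ieval s i) (ieval s e)) s.(qmem))
| run_qset a i e s :
    run (PQSet a i e) s (icost i + qcost e).+1
      (Store s.(imem) (upd s.(qmem) a (ieval s i) (qeval s e)))
| run_seq c1 c2 s1 s2 s3 t1 t2 :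
    run c1 s1 t1 s2 -> run c2 s2 t2 s3 ->
    run (PSeq c1 c2) s1 (t1 + t2) s3
| run_if b c1 c2 s s' t :
    run (if teval s b then c1 else c2) s t s' ->
    run (PIf b c1 c2) s (tcost b + t) s'
| run_while_stop b c s :
    ~~ teval s b -> run (PWhile b c) s (tcost b) s
| run_while_step b c s1 s2 s3 t1 t2 :
    teval s1 b -> run c s1 t1 s2 -> run (PWhile b c) s2 t2 s3 ->
    run (PWhile b c) s1 (tcost b + t1 + t2) s3.

(* Input: n and m in cells 0 and 1 of index array 0, the 0/1 adjacency matrix
   row by row in index array 1; all other cells are 0. *)
Definition input n (G : sgraph n) (m : nat) : store :=
  Store
    (fun a k =>
       match a, k with
       | 0, 0 => n
       | 0, 1 => m
       | 1, _ => [exists u : 'I_n, exists v : 'I_n,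
                   (k == u * n + v)%N && G u v] : nat
       | _, _ => 0
       end%N)
    (fun _ _ => 0).

(* Output: the indicator of a vertex set in cells 0, ..., n-1 of index array 2;
   a nonzero value means membership. *)
Definition output n (s : store) : {set 'I_n} :=
  [set u : 'I_n | s.(imem) 2 u != 0%N].

(* On input (G, m), p halts within n^(C ln m) steps and returns an m-subset
   whose density is as required.  The constant C is a parameter here: the
   statement quantifies it before all inputs. *)
Definition finds_dense_subset (R : realType) (gamma C : R) (p : prog)
    (n m : nat) (G : sgraph n) : Prop :=
  exists (t : nat) (s : store),
    [/\ run p (input G m) t s,
        t%:R <= n%:R `^ (C * ln (m%:R : R)),
        #|output n s| = m &
        expR (gamma * m%:R * sigma R G (output n s))
          >= 2^-1 * 'C(n, m)%:R^-1 * Density gamma m G].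

(* Main.v *)
Require Import Defs.
From mathcomp Require Import all_boot all_order all_algebra.
From mathcomp Require Import reals sequences exp.
From mathcomp Require Import fingroup perm ring lra zify.
From Stdlib Require Import FunctionalExtensionality.

(** Write h(T) for the number of non-adjacent pairs inside a vertex set T, and
    b = 2 g / (m - 1), where g is the constant of the claim.  On m-sets the
    objective exp(g m sigma(S)) equals exp(g m - b h(S)) ([objectiveE]), and
    the weight of T is at most exp(g m + 1/50 - b h(T)) ([weight_le]).  It is
    therefore enough to find an m-set S for which exp(- b h(S)) is, up to a
    constant factor, at least the average of exp(- b h(T)) over all m-sets T.
    The total interaction felt by one vertex of T is about 2 g, which is small,
    and in this regime the mean-field approximation of the average is correct
    up to a constant factor; moreover it can be computed and rounded in
    polynomial time, which is more than is asked for, since m >= 2.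

    The upper bound on the average.  The average over k-sets is at most the
    average over k independent uniform vertices, because the quadratic form h
    is concave along every direction e_i - e_j
    ([without_le_with_replacement]).  For independent vertices, tilt the
    uniform law by exp(- y), where y(v) is b times the expected number of
    non-neighbours of v among k - 1 draws from the tilted law pi itself.  The
    part of the exponent that is linear in the sample cancels, and what remains
    is a degenerate quadratic chaos, whose exponential moment is at most e^(2/5)
    as soon as b k <= 2/5 ([chaos_moment]).  This bounds the average by a constant times
    exp(- b h(k pi)), with h extended to real vectors ([mean_field_bound]).

    The algorithm.  The map sending a law pi to the law proportional to
    exp(- y) contracts the exponents y by the factor 1/2 ([mf_contract]).  Its
    iterates are computed exactly in rational arithmetic, with (1 - y / N)^N in
    place of exp(- y).  The resulting fractional point p = k pi is rounded by
    moving mass between two coordinates at a time: h is concave along such a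
    move, so one of the two directions does not increase it ([transfer_bil],
    [shift_to_spec]), and each move makes a coordinate integral.  Rounding
    needs p <= 1.  Since pi is within a factor 2 of uniform, this holds when
    2 k <= n; if 2 m > n, the whole argument is applied to the complement of T,
    with k = n - m, which adds a linear term to h ([nonedges_flip]).

    The losses add up to 2/5 for the chaos, 1/5 for replacing k (k - 1) by k^2,
    1/50 for the arithmetic and 1/50 for the weights, and e^(64/100) <= 2. *)

Set Implicit Arguments.
Unset Strict Implicit.
Unset Printing Implicit Defensive.
Import Order.TTheory GRing.Theory Num.Theory.
Local Open Scope ring_scope.

(** * Elementary bounds on the exponential *)

Section ExpBounds.
Variable R : realType.
Implicit Types x y z : R.

(** Square the bound at z / 2.  Up to higher-order terms the constant K becomes
    (1 + 2 K) / 4, half way from K to the optimal 1/2. *)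
Lemma expR_quad_double (K K' M z : R) : 0 <= K -> 0 <= M ->
  (1 + 2 * K) / 4 + K * M / 2 + K ^+ 2 * M ^+ 2 / 4 <= K' ->
  (forall z, `|z| <= M -> expR z <= 1 + z + K * z ^+ 2) ->
  `|z| <= 2 * M -> expR z <= 1 + z + K' * z ^+ 2.
Proof.
move=> K0 M0 KK' IH zM.
have zz : z = z / 2 + z / 2 by field.
have hM : `|z / 2| <= M.
  by rewrite normrM [`|2^-1|]ger0_norm ?invr_ge0 // ler_pdivrMr // mulrC.
have := IH _ hM; set s := z / 2 in zz hM *; rewrite zz expRD => hs.
apply: le_trans (ler_pM (expR_ge0 _) (expR_ge0 _) hs hs) _.
have s2 : s ^+ 2 <= M ^+ 2 by rewrite -[s ^+ 2]ger0_norm ?sqr_ge0 // normrX ler_sqr ?nnegrE.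
have s1 : s <= M by apply: le_trans hM; exact: ler_norm.
have s20 : 0 <= s ^+ 2 by exact: sqr_ge0.
have : 0 <= s ^+ 2 * (4 * K' - ((1 + 2 * K) + 2 * K * s + K ^+ 2 * s ^+ 2)).
  apply: mulr_ge0 => //.
  have : 0 <= K * (M - s) by apply: mulr_ge0 => //; lra.
  have : 0 <= K ^+ 2 * (M ^+ 2 - s ^+ 2) by apply: mulr_ge0; [exact: sqr_ge0|lra].
  lra.
lra.
Qed.

(** The sharp constant on this range is about 0.66; three doublings, starting
    from the elementary bound 1 / (1 - z), lose little. *)
Lemma expR_le_quad z : `|z| <= 4 / 5 -> expR z <= 1 + z + 5 / 6 * z ^+ 2.
Proof.
have base z' : `|z'| <= 1 / 10 -> expR z' <= 1 + z' + 10 / 9 * z' ^+ 2.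
  rewrite ler_norml => /andP[l u].
  have := expR_ge1Dx (- z'); rewrite expRN => h.
  have e0 := expR_gt0 z'.
  have : (1 - z') * expR z' <= 1.
    have := ler_wpM2r (ltW e0) h; by rewrite mulVf ?gt_eqF.
  move=> h1; have z10 : 0 < 1 - z' by lra.
  rewrite -(ler_pM2l z10); apply: le_trans h1 _.
  have : 0 <= z' ^+ 2 * (1 / 10 - z') by apply: mulr_ge0; [exact: sqr_ge0|lra].
  lra.
have e2 z' : `|z'| <= 1 / 5 -> expR z' <= 1 + z' + 87 / 100 * z' ^+ 2.
  move=> h; apply: (@expR_quad_double (10 / 9) _ (1 / 10)) base _; lra.
have e3 z' : `|z'| <= 2 / 5 -> expR z' <= 1 + z' + 79 / 100 * z' ^+ 2.
  move=> h; apply: (@expR_quad_double (87 / 100) _ (1 / 5)) e2 _; lra.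
move=> h; apply: (@expR_quad_double (79 / 100) _ (2 / 5)) e3 _; lra.
Qed.

Lemma expR_le2 z : z <= 64 / 100 -> expR z <= 2.
Proof.
move=> hz.
have h8 : expR (- (8 / 100) : R) >= 92 / 100.
  by have := expR_ge1Dx (- (8 / 100) : R); lra.
have : expR (- (64 / 100) : R) >= 1 / 2.
  have -> : - (64 / 100) = - (8 / 100) * 8%:R :> R by lra.
  rewrite expRM_natr; apply: le_trans (_ : (92 / 100) ^+ 8 <= _); first lra.
  by apply: lerXn2r => //; rewrite nnegrE ?expR_ge0 //; lra.
have := expRxMexpNx_1 (64 / 100 : R).
have := expR_gt0 (64 / 100 : R); have : expR z <= expR (64 / 100) by rewrite ler_expR.
nra.
Qed.

Lemma one_sub_ge_expR z : `|z| <= 1 / 2 -> expR (- z - 2 * z ^+ 2) <= 1 - z.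
Proof.
rewrite ler_norml => /andP[l u].
have e0 := expR_gt0 (z + 2 * z ^+ 2).
have h := expR_ge1Dx (z + 2 * z ^+ 2).
have -> : - z - 2 * z ^+ 2 = - (z + 2 * z ^+ 2) by ring.
rewrite expRN -[X in X <= _]mul1r ler_pdivrMr //.
have z10 : 0 <= 1 - z by lra.
have := ler_wpM2l z10 h; apply: le_trans.
have : 0 <= z ^+ 2 * (1 / 2 - z) by apply: mulr_ge0; [exact: sqr_ge0|lra].
lra.
Qed.

Lemma expR_le_one_add z : 0 <= z -> expR (z - z ^+ 2) <= 1 + z.
Proof.
move=> z0.
have e0 := expR_gt0 (- z + z ^+ 2); have h := expR_ge1Dx (- z + z ^+ 2).
have -> : z - z ^+ 2 = - (- z + z ^+ 2) by ring.
rewrite expRN -[X in X <= _]mul1r ler_pdivrMr //.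
have z10 : 0 <= 1 + z by lra.
have := ler_wpM2l z10 h; apply: le_trans.
have : 0 <= z ^+ 3 by exact: exprn_ge0.
lra.
Qed.

(** Jensen's inequality, from the tangent line of the exponential at the mean. *)
Lemma expR_jensen (I : finType) (mu a : I -> R) :
  (forall i, 0 <= mu i) -> \sum_i mu i = 1 ->
  expR (\sum_i mu i * a i) <= \sum_i mu i * expR (a i).
Proof.
move=> mu0 mu1; set A := \sum_i _.
rewrite -[X in X <= _]mul1r.
have -> : 1 = \sum_i mu i * (1 + (a i - A)).
  under eq_bigr do rewrite mulrDr mulr1 mulrBr.
  by rewrite big_split /= sumrB -mulr_suml mu1 mul1r -/A subrr addr0.
rewrite mulr_suml; apply: ler_sum => i _.
rewrite -mulrA; apply: ler_wpM2l => //.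
have -> : a i = (a i - A) + A by ring.
rewrite expRD addrK; apply: ler_wpM2r; first exact: expR_ge0.
exact: expR_ge1Dx.
Qed.

Lemma expR_convex2 (s a b : R) : 0 <= s <= 1 ->
  expR ((1 - s) * a + s * b) <= (1 - s) * expR a + s * expR b.
Proof.
case/andP=> s0 s1.
have := @expR_jensen bool (fun i => if i then s else 1 - s) (fun i => if i then b else a).
rewrite !big_bool /= => h; rewrite addrC [leRHS]addrC; apply: h; last by ring.
by case; lra.
Qed.

End ExpBounds.

(** * Quadratic forms on vectors indexed by vertices *)

Lemma sum_ind (F : realFieldType) (V : finType) (f : V -> F) v : \sum_w (w == v)%:R * f w = f v.
Proof.
rewrite (bigD1 v) //= eqxx mul1r big1 ?addr0 // => w /negPf->.
by rewrite mul0r.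
Qed.

Section Quadratic.
Variables (F : realFieldType) (V : finType) (H : V -> V -> F).
Implicit Types (x y d c : V -> F).

(** For symmetric H, [field H x] is the gradient at x of half the form
    [bil H x x]. *)
Definition field x v := \sum_w H v w * x w.
Definition bil x y := \sum_v x v * field y v.
Definition quad c x := \sum_v c v * x v + 2^-1 * bil x x.

Lemma eq_field x y : x =1 y -> field x =1 field y.
Proof. by move=> e v; apply: eq_bigr => w _; rewrite e. Qed.

Lemma eq_bil x x' y y' : x =1 x' -> y =1 y' -> bil x y = bil x' y'.
Proof. by move=> e e'; apply: eq_bigr => w _; rewrite e (eq_field e'). Qed.

Lemma eq_quad c x y : x =1 y -> quad c x = quad c y.
Proof.
move=> e; rewrite /quad (eq_bil e e); congr (_ + _).
by apply: eq_bigr => v _; rewrite e.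
Qed.

Lemma field_lin x d s v :
  field (fun w => x w + s * d w) v = field x v + s * field d v.
Proof.
rewrite /field mulr_sumr -big_split /=; apply: eq_bigr => w _; ring.
Qed.

Lemma bil_linl x d s y :
  bil (fun w => x w + s * d w) y = bil x y + s * bil d y.
Proof.
rewrite /bil mulr_sumr -big_split /=; apply: eq_bigr => w _; ring.
Qed.

Lemma bil_linr x d s y :
  bil y (fun w => x w + s * d w) = bil y x + s * bil y d.
Proof.
rewrite /bil mulr_sumr -big_split /=; apply: eq_bigr => w _.
by rewrite field_lin; ring.
Qed.

Lemma lin_lin c x d s :
  \sum_v c v * (x v + s * d v) = \sum_v c v * x v + s * \sum_v c v * d v.
Proof. by rewrite mulr_sumr -big_split /=; apply: eq_bigr => w _; ring. Qed.

(** Along a segment a quadratic form exceeds its chord by an amount that only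
    involves the form on the direction of the segment. *)
Lemma quad_chord c x d s :
  quad c (fun v => x v + s * d v) =
  (1 - s) * quad c x + s * quad c (fun v => x v + d v)
  - s * (1 - s) * (2^-1 * bil d d).
Proof.
have -> : quad c (fun v => x v + d v) = quad c (fun v => x v + 1 * d v).
  by apply: eq_quad => v; rewrite mul1r.
rewrite /quad !bil_linl !bil_linr !lin_lin; ring.
Qed.

Hypothesis H_ge0 : forall v w, 0 <= H v w.
Hypothesis H_diag : forall v, H v v = 0.

(** Concavity along transfers: on d = t (e_i - e_j) only the off-diagonal entries
    of H contribute, with a negative sign. *)
Lemma bil_transfer t i j d :
    (forall v, d v = t * ((v == i)%:R - (v == j)%:R)) ->
  bil d d <= 0.
Proof.
move=> dE.
have fE v : field d v = t * (H v i - H v j).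
  transitivity (t * (\sum_w (w == i)%:R * H v w - \sum_w (w == j)%:R * H v w)).
    by rewrite -sumrB mulr_sumr; apply: eq_bigr => w _; rewrite dE; ring.
  by rewrite !sum_ind.
rewrite /bil; under eq_bigr do rewrite fE dE.
have -> : \sum_v t * ((v == i)%:R - (v == j)%:R) * (t * (H v i - H v j)) =
   t * t * ((H i i - H i j) - (H j i - H j j)).
  transitivity (t * t * (\sum_v ((v == i)%:R * (H v i - H v j)) -
                \sum_v ((v == j)%:R * (H v i - H v j)))).
    by rewrite -sumrB mulr_sumr; apply: eq_bigr => v _; ring.
  by rewrite !sum_ind.
rewrite !H_diag.
have h1 := H_ge0 i j; have h2 := H_ge0 j i.
have : 0 <= t * t * (H i j + H j i).
  by apply: mulr_ge0; [rewrite -expr2 sqr_ge0 | rewrite addr_ge0].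
lra.
Qed.

End Quadratic.

(** * Sampling with and without replacement *)

Section IterSum.
Variables (R : realType) (V : finType).
Implicit Types (mu : V -> R) (x : {ffun V -> nat}).

Definition incr x v : {ffun V -> nat} := [ffun w => (x w + (w == v))%N].

(** The sum of mu(u_1) ... mu(u_k) Phi over all sequences u_1, ..., u_k, where
    Phi sees a sequence only through its occupation numbers, added to x. *)
Fixpoint isum mu (k : nat) (Phi : {ffun V -> nat} -> R) x : R :=
  if k is k'.+1 then \sum_v mu v * isum mu k' Phi (incr x v) else Phi x.

Lemma sum_incr x v : (\sum_w incr x v w = (\sum_w x w).+1)%N.
Proof.
under eq_bigr do rewrite ffunE.
rewrite big_split /= -addn1; congr (_ + _)%N.
by rewrite (bigD1 v) //= eqxx big1 // => w /negPf->.
Qed.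

Lemma ler_isum mu mu' k (Phi Psi : {ffun V -> nat} -> R) x :
    (forall v, 0 <= mu v <= mu' v) ->
    (forall y : {ffun V -> nat}, (\sum_w y w = \sum_w x w + k)%N -> 0 <= Phi y <= Psi y) ->
  0 <= isum mu k Phi x <= isum mu' k Psi x.
Proof.
move=> mumu; elim: k x => [|k IH] x h /=; first by apply: h; rewrite addn0.
have h' v : 0 <= isum mu k Phi (incr x v) <= isum mu' k Psi (incr x v).
  by apply: IH => y; rewrite sum_incr addSnnS => /h.
apply/andP; split.
  by apply: sumr_ge0 => v _; case/andP: (h' v) (mumu v) => ? _ /andP[? _]; rewrite mulr_ge0.
apply: ler_sum => v _; case/andP: (h' v) (mumu v) => ? ? /andP[? ?].
exact: ler_pM.
Qed.

Lemma isum_cst mu k (a : R) x : \sum_v mu v = 1 -> isum mu k (fun=> a) x = a.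
Proof.
move=> mu1; elim: k x => //= k IH x.
by under eq_bigr do rewrite IH; rewrite -mulr_suml mu1 mul1r.
Qed.

Lemma isum_sum mu k (I : finType) (Phi : I -> {ffun V -> nat} -> R) x :
  isum mu k (fun y => \sum_i Phi i y) x = \sum_i isum mu k (Phi i) x.
Proof.
elim: k x => //= k IH x; rewrite exchange_big /=; apply: eq_bigr => v _.
by rewrite IH mulr_sumr.
Qed.

Lemma isum_scale mu k (a : R) Phi x :
  isum (fun v => a * mu v) k Phi x = a ^+ k * isum mu k Phi x.
Proof.
elim: k x => [|k IH] x /=; first by rewrite expr0 mul1r.
by rewrite mulr_sumr; apply: eq_bigr => v _; rewrite IH exprS; ring.
Qed.

Lemma isumZ mu k (a : R) Phi x :
  isum mu k (fun y => a * Phi y) x = a * isum mu k Phi x.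
Proof.
elim: k x => //= k IH x; rewrite mulr_sumr; apply: eq_bigr => v _.
by rewrite IH mulrCA.
Qed.

Definition relabel x (s : {perm V}) : {ffun V -> nat} := [ffun v => x (s v)].

Lemma isum_relabel (mu0 : R) k (Phi : {ffun V -> nat} -> R) (s : {perm V}) x :
  isum (fun=> mu0) k (fun y => Phi (relabel y s)) x =
  isum (fun=> mu0) k Phi (relabel x s).
Proof.
elim: k x => //= k IH x.
rewrite (reindex_inj (@perm_inj _ s)) /=; apply: eq_bigr => v _.
rewrite IH; congr (_ * isum _ _ _ _); apply/ffunP => w.
by rewrite !ffunE (inj_eq perm_inj).
Qed.

End IterSum.

Section Sampling.
Variables (R : realType) (V : finType) (H : V -> V -> R) (c : V -> R) (b : R).
Hypothesis H_ge0 : forall v w, 0 <= H v w.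
Hypothesis H_diag : forall v, H v v = 0.
Hypothesis b_ge0 : 0 <= b.
Implicit Types (x : {ffun V -> nat}) (T : {set V}).

Definition gibbs x : R := expR (- (b * quad H c (fun v => (x v)%:R))).

(** Averaging over relabellings makes the Gibbs factor a symmetric function
    of the occupation numbers, hence Schur-convex given its convexity along
    transfers; the next two lemmas are this argument. *)
Definition symgibbs x : R := \sum_(s : {perm V}) gibbs (relabel x s).

Definition ind T : {ffun V -> nat} := [ffun v => (v \in T : nat)].

Definition shift_unit x i j : {ffun V -> nat} :=
  [ffun v => if v == i then (x v).-1 else if v == j then (x v).+1 else x v].

(** Moving one of a = x i units to the empty cell j gives a point of the
    segment from x to its image under the transposition of i and j, a
    fraction 1/a of the way.  The Gibbs factor is convex on that segment, and both
    ends have the same symmetrised value. *)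
Lemma symgibbs_shift x i j : (0 < x i)%N -> x j = 0%N ->
  symgibbs (shift_unit x i j) <= symgibbs x.
Proof.
move=> xi xj.
have ij : i != j by apply/eqP => ij; rewrite ij xj in xi.
pose a : R := (x i)%:R.
have a0 : 0 < a by rewrite ltr0n.
have a1 : 1 <= a by rewrite ler1n.
have s01 : 0 <= a^-1 <= 1 by rewrite invr_ge0 ltW //= invf_le1.
have swapE : symgibbs x = \sum_(s : {perm V}) gibbs (relabel x (s * tperm i j)%g).
  rewrite /symgibbs (reindex_inj (mulIg (tperm i j))) /=; exact: eq_bigr.
have -> : symgibbs x = \sum_(s : {perm V}) ((1 - a^-1) * gibbs (relabel x s) +
    a^-1 * gibbs (relabel x (s * tperm i j)%g)).
  by rewrite big_split /= -!mulr_sumr -swapE -/(symgibbs x); ring.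
apply: ler_sum => s _.
apply: le_trans (expR_convex2 _ _ s01); rewrite ler_expR.
pose X v : R := (relabel x s v)%:R.
pose d v : R := (- a) * ((v == (s^-1)%g i)%:R - (v == (s^-1)%g j)%:R).
have eqs k v : (s v == k) = (v == (s^-1)%g k).
  by apply/eqP/eqP => [<-|->]; rewrite ?permK ?permKV.
have X'E : (fun v => (relabel (shift_unit x i j) s v)%:R) =1 (fun v => X v + a^-1 * d v).
  move=> v; rewrite /X /d !ffunE -!eqs.
  case: (eqVneq (s v) i) => [->|ni].
    rewrite (negPf ij) subr0 mulr1 mulrN mulVf ?gt_eqF //.
    by rewrite -[in RHS](prednK xi) -natr1 addrK.
  case: (eqVneq (s v) j) => [->|nj].
    by rewrite xj sub0r mulrNN mulr1 add0r mulVf ?gt_eqF.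
  by rewrite subr0 mulr0 mulr0 addr0.
have X2E : (fun v => (relabel x (s * tperm i j)%g v)%:R) =1 (fun v => X v + d v).
  move=> v; rewrite /X /d !ffunE -!eqs permM.
  case: tpermP => [->|->|/eqP/negPf ni /eqP/negPf nj].
  - by rewrite eqxx (negPf ij) xj subr0 mulr1 subrr.
  - by rewrite eqxx eq_sym (negPf ij) xj sub0r mulrNN mulr1 add0r.
  - by rewrite ni nj subr0 mulr0 addr0.
rewrite (eq_quad _ _ X'E) (eq_quad _ _ X2E) quad_chord.
have dd : bil H d d <= 0.
  by apply: (@bil_transfer _ _ _ H_ge0 H_diag (- a) ((s^-1)%g i) ((s^-1)%g j)).
rewrite -/X.
case/andP: s01 => s0 s1.
have : 0 <= b * (a^-1 * (1 - a^-1) * (2^-1 * - bil H d d)).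
  by rewrite !mulr_ge0 ?subr_ge0 ?oppr_ge0 ?invr_ge0.
set q1 := quad _ _ _; set q2 := quad _ _ _; set B := bil _ _ _; lra.
Qed.

(** As long as x differs from the indicator of T, a unit can be moved from a
    cell where x is too large to an empty cell of T. *)
Lemma symgibbs_min x T : (\sum_v x v = #|T|)%N -> symgibbs (ind T) <= symgibbs x.
Proof.
have [N] := ubnP (\sum_v (x v - ind T v))%N.
elim: N x => // N IH x hN xT.
have sT : (\sum_v ind T v = #|T|)%N.
  by under eq_bigr do rewrite ffunE; rewrite -big_mkcond /= sum1_card.
case: (pickP (fun v => ind T v < x v)%N) => [i hi|h0]; last first.
  suff -> : ind T = x by [].
  have le v : (x v <= ind T v)%N by rewrite leqNgt h0.
  apply/ffunP => v; apply/eqP; rewrite eqn_leq le andbT.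
  rewrite leqNgt; apply/negP => lt.
  suff : (\sum_v x v < \sum_v ind T v)%N by rewrite xT sT ltnn.
  rewrite [X in (X < _)%N](bigD1 v) // [X in (_ < X)%N](bigD1 v) //=.
  by rewrite -addSn leq_add // leq_sum.
case: (pickP (fun v => x v < ind T v)%N) => [j hj|h0]; last first.
  suff : (\sum_v ind T v < \sum_v x v)%N by rewrite xT sT ltnn.
  rewrite [X in (X < _)%N](bigD1 i) // [X in (_ < X)%N](bigD1 i) //=.
  by rewrite -addSn leq_add // leq_sum // => w _; rewrite leqNgt h0.
have xi : (0 < x i)%N by apply: leq_ltn_trans hi.
have ij : i != j by apply/eqP => ij; move: hi hj; rewrite ij; lia.
have xj : x j = 0%N by move: hj; rewrite ffunE; case: (j \in T) => //=; lia.
apply: le_trans (symgibbs_shift xi xj); apply: IH.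
- rewrite ltnS in hN; apply: leq_trans hN.
  rewrite [X in (X < _)%N](bigD1 i) // [X in (_ < X)%N](bigD1 i) //=.
  rewrite -addSn leq_add //.
    by rewrite [shift_unit _ _ _ _]ffunE eqxx; lia.
  apply: leq_sum => w wi; rewrite [shift_unit _ _ _ _]ffunE (negPf wi).
  by case: eqP => [->|//]; rewrite xj; lia.
- rewrite -xT (bigD1 i) // (bigD1 j) /=; last by rewrite eq_sym.
  rewrite [RHS](bigD1 i) // [X in (_ = _ + X)%N](bigD1 j) /=; last by rewrite eq_sym.
  rewrite ![shift_unit _ _ _ _]ffunE eqxx eq_sym (negPf ij) eqxx xj.
  have -> : (\sum_(v | (v != i) && (v != j)) shift_unit x i j v =
             \sum_(v | (v != i) && (v != j)) x v)%N.
    by apply: eq_bigr => w /andP[wi wj]; rewrite ffunE (negPf wi) (negPf wj).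
  lia.
Qed.

(** Compare any sequence of k draws with any k-set T0 through [symgibbs_min], and
    average over the sequences and over T0. *)
Lemma without_le_with_replacement k : (0 < #|V|)%N ->
  ('C(#|V|, k)%:R : R)^-1 * \sum_(T : {set V} | #|T| == k) gibbs (ind T)
  <= isum (fun=> (#|V|%:R)^-1) k gibbs [ffun=> 0%N].
Proof.
move=> V0.
have mumu (v : V) : 0 <= (#|V|%:R^-1 : R) <= #|V|%:R^-1.
  by rewrite invr_ge0 ler0n lexx.
have [kn|nk] := leqP k #|V|; last first.
  rewrite bin_small // invr0 mul0r.
  have gg (y : {ffun V -> nat}) : (\sum_w y w = \sum_w ([ffun=> 0%N] : {ffun V -> nat}) w + k)%N ->
      0 <= gibbs y <= gibbs y by rewrite lexx expR_ge0.
  by have /andP[] := ler_isum mumu gg.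
set A := isum _ _ _ _.
pose P : R := #|{perm V}|%:R.
have P0 : 0 < P by rewrite ltr0n; apply/card_gt0P; exists 1%g.
have mu1 : \sum_(v : V) (#|V|%:R^-1 : R) = 1.
  by rewrite sumr_const -[_ *+ _]mulr_natl mulfV // pnatr_eq0 -lt0n.
have symA : isum (fun=> #|V|%:R^-1) k symgibbs [ffun=> 0%N] = P * A.
  rewrite /symgibbs isum_sum.
  under eq_bigr => s _.
    rewrite isum_relabel (_ : relabel _ s = [ffun=> 0%N]); last by apply/ffunP => v; rewrite !ffunE.
    over.
  by rewrite sumr_const mulr_natl.
have lower T : #|T| = k -> symgibbs (ind T) <= P * A.
  move=> Tk; rewrite -symA -[X in X <= _](isum_cst k (symgibbs (ind T)) [ffun=> 0%N] mu1).
  have gg (y : {ffun V -> nat}) : (\sum_w y w = \sum_w ([ffun=> 0%N] : {ffun V -> nat}) w + k)%N ->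
      0 <= symgibbs (ind T) <= symgibbs y.
    rewrite [X in _ = (X + _)%N]big1 ?add0n; last by move=> v; rewrite ffunE.
    move=> yk; rewrite symgibbs_min ?Tk // andbT.
    by apply: sumr_ge0 => s _; exact: expR_ge0.
  by have /andP[] := ler_isum mumu gg.
have tot : \sum_(T : {set V} | #|T| == k) symgibbs (ind T) =
           P * \sum_(T : {set V} | #|T| == k) gibbs (ind T).
  rewrite exchange_big /= mulr_natl -sumr_const; apply: eq_bigr => s _.
  rewrite [RHS](reindex (fun T : {set V} => s @^-1: T)) /=; last first.
    exists (fun T : {set V} => (s^-1)%g @^-1: T) => T _; apply/setP => v.
      by rewrite !inE permKV.
    by rewrite !inE permK.
  apply: eq_big => T; first by rewrite card_preimset //; exact: perm_inj.
  by move=> _; congr gibbs; apply/ffunP => v; rewrite !ffunE inE.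
have C0 : (0 : R) < 'C(#|V|, k)%:R by rewrite ltr0n bin_gt0.
rewrite mulrC ler_pdivrMr // -(ler_pM2l P0) -tot mulrA.
apply: le_trans (_ : \sum_(T : {set V} | #|T| == k) (P * A) <= _).
  by apply: ler_sum => T /eqP/lower.
rewrite sumr_const.
have -> : #|[pred T : {set V} | #|T| == k]| = 'C(#|V|, k).
  have := @card_draws V k; rewrite cardE => <-.
  by rewrite -cardE; apply: eq_card => T; rewrite !inE.
by rewrite mulr_natr.
Qed.

End Sampling.

(** * The exponential moment of a degenerate quadratic chaos *)

Section Chaos.
Variables (R : realType) (V : finType) (H : V -> V -> R) (pi : V -> R).
Hypothesis H_sym : forall v w, H v w = H w v.
Hypothesis H_01 : forall v w, 0 <= H v w <= 1.
Hypothesis H_diag : forall v, H v v = 0.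
Hypothesis pi_ge0 : forall v, 0 <= pi v.
Hypothesis pi_sum : \sum_v pi v = 1.
Implicit Types (x : {ffun V -> nat}).

Local Notation E f := (\sum_v pi v * f v).

Lemma mean_le (f g : V -> R) : (forall v, f v <= g v) -> E f <= E g.
Proof. by move=> fg; apply: ler_sum => v _; exact: ler_wpM2l. Qed.

Lemma mean_cst (a : R) : E (fun=> a) = a.
Proof. by rewrite -mulr_suml pi_sum mul1r. Qed.

Lemma meanD (f g : V -> R) (a : R) : E (fun v => f v + a * g v) = E f + a * E g.
Proof. by rewrite mulr_sumr -big_split; apply: eq_bigr => v _ /=; ring. Qed.

Lemma mean_bounds (f : V -> R) a b : (forall v, a <= f v <= b) -> a <= E f <= b.
Proof.
move=> h; rewrite -[X in X <= _](mean_cst a) -[X in _ && (_ <= X)](mean_cst b).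
by apply/andP; split; apply: mean_le => v; case/andP: (h v).
Qed.

Lemma mean_sqr (f : V -> R) : E f ^+ 2 <= E (fun v => f v ^+ 2).
Proof.
set a := E f.
have : 0 <= E (fun v => (f v - a) ^+ 2).
  by apply: sumr_ge0 => v _; rewrite mulr_ge0 // sqr_ge0.
have -> : E (fun v => (f v - a) ^+ 2) = E (fun v => f v ^+ 2) - 2 * a * a + a ^+ 2.
  transitivity (E (fun v => (f v ^+ 2 + (- 2 * a) * f v) + a ^+ 2 * 1)).
    by apply: eq_bigr => v _; ring.
  by rewrite !meanD mean_cst -/a; ring.
lra.
Qed.

Let h v := field H pi v.
Let q := E h.

Lemma field_01 v : 0 <= h v <= 1.
Proof.
rewrite /h /field; under eq_bigr do rewrite mulrC.
exact: (mean_bounds (H_01 v)).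
Qed.

Lemma bil_01 : 0 <= q <= 1.
Proof. exact: (mean_bounds field_01). Qed.

(** The degenerate (Hoeffding) part of H under pi: its mean in either variable
    is zero. *)
Definition centred v w := H v w - h v - h w + q.

Lemma centred_sym v w : centred v w = centred w v.
Proof. by rewrite /centred H_sym; ring. Qed.

Lemma mean_H v : E (H v) = h v.
Proof. by apply: eq_bigr => w _; rewrite mulrC. Qed.

Let dev v w := H v w - h w.

Lemma dev_bound v w : -1 <= dev v w <= 1.
Proof. by rewrite /dev; case/andP: (H_01 v w) (field_01 w) => ? ? /andP[? ?]; lra. Qed.

Lemma mean_dev v : E (dev v) = h v - q.
Proof.
rewrite /dev -mean_H -/q /q; transitivity (E (fun w => H v w + (-1) * h w)).
  by apply: eq_bigr => w _; ring.
by rewrite meanD; ring.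
Qed.

Lemma centredE v w : centred v w = dev v w - (h v - q).
Proof. by rewrite /centred /dev; ring. Qed.

Lemma mean_centred v : E (centred v) = 0.
Proof.
transitivity (E (fun w => dev v w + (- (h v - q)) * 1)).
  by apply: eq_bigr => w _; rewrite centredE; ring.
by rewrite meanD mean_cst mean_dev; ring.
Qed.

Lemma centred_bound v w : `|centred v w| <= 2.
Proof.
rewrite centredE ler_norml; case/andP: (dev_bound v w) => ? ?.
have := mean_bounds (dev_bound v); rewrite mean_dev => /andP[? ?]; lra.
Qed.

Lemma centred_var v : E (fun w => centred v w ^+ 2) <= 1.
Proof.
have -> : E (fun w => centred v w ^+ 2) = E (fun w => dev v w ^+ 2) - (h v - q) ^+ 2.
  transitivity (E (fun w => (dev v w ^+ 2 + (- 2 * (h v - q)) * dev v w) + (h v - q) ^+ 2 * 1)).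
    by apply: eq_bigr => w _; rewrite centredE; ring.
  by rewrite !meanD mean_cst mean_dev; ring.
have : E (fun w => dev v w ^+ 2) <= 1.
  have /andP[//] : 0 <= E (fun w => dev v w ^+ 2) <= 1.
  apply: mean_bounds => w; case/andP: (dev_bound v w) => ? ?; rewrite sqr_ge0 /=; nra.
have := sqr_ge0 (h v - q); lra.
Qed.

Let X x v : R := (x v)%:R.
Let sz x : R := \sum_v X x v.

(** The sum of [centred] over the pairs of a sample with occupation numbers x,
    written without choosing an order of the sample; see [chaos_incr]. *)
Definition chaos x : R :=
  2^-1 * bil H (X x) (X x) - (sz x - 1) * \sum_v X x v * h v
  + 2^-1 * (sz x * (sz x - 1)) * q.

(** The increment of the chaos when w is drawn next. *)
Definition influence x w : R := \sum_v X x v * centred v w.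

Definition energy x : R := E (fun w => influence x w ^+ 2).

Definition cross x v : R := E (fun w => influence x w * centred v w).

Lemma X_incr x v w : X (incr x v) w = X x w + 1 * (w == v)%:R.
Proof. by rewrite /X ffunE natrD mul1r. Qed.

Lemma sz_incr x v : sz (incr x v) = sz x + 1.
Proof.
rewrite /sz; under eq_bigr do rewrite X_incr mul1r.
rewrite big_split /=; congr (_ + _).
by rewrite -[RHS](sum_ind (fun=> 1) v); apply: eq_bigr => w _; rewrite mulr1.
Qed.

Lemma influence_incr x v w : influence (incr x v) w = influence x w + centred v w.
Proof.
rewrite /influence; under eq_bigr do rewrite X_incr mul1r mulrDl.
by rewrite big_split /= sum_ind.
Qed.

Lemma chaos_incr x v : chaos (incr x v) = chaos x + influence x v.
Proof.
have infE : influence x v =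
    field H (X x) v - \sum_w X x w * h w - sz x * h v + sz x * q.
  rewrite /influence /field /sz !mulr_suml -!sumrB -big_split /=.
  by apply: eq_bigr => w _; rewrite /centred (H_sym w v); ring.
have linE : \sum_w X (incr x v) w * h w = \sum_w X x w * h w + h v.
  under eq_bigr do rewrite X_incr mul1r mulrDl.
  by rewrite big_split /= sum_ind.
have bilE : bil H (X (incr x v)) (X (incr x v)) = bil H (X x) (X x) + 2 * field H (X x) v.
  rewrite (eq_bil _ (X_incr x v) (X_incr x v)) bil_linl !bil_linr !mul1r.
  have -> : bil H (fun w => (w == v)%:R) (X x) = field H (X x) v.
    by rewrite /bil sum_ind.
  have -> : bil H (fun w => (w == v)%:R) (fun w => (w == v)%:R) = 0.
    rewrite /bil sum_ind /field -[RHS](H_diag v) -(sum_ind (H v) v).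
    by apply: eq_bigr => w _; rewrite mulrC.
  have -> : bil H (X x) (fun w => (w == v)%:R) = field H (X x) v.
    apply: eq_bigr => w _; rewrite H_sym mulrC; congr (_ * _).
    by rewrite -(sum_ind (H w) v); apply: eq_bigr => u _; rewrite mulrC.
  ring.
rewrite /chaos sz_incr linE bilE infE; by field.
Qed.

Lemma energy_incr x v : energy (incr x v) =
  energy x + 2 * cross x v + E (fun w => centred v w ^+ 2).
Proof.
transitivity (E (fun w => (influence x w ^+ 2 + 2 * (influence x w * centred v w))
   + 1 * (centred v w ^+ 2))).
  by apply: eq_bigr => w _; rewrite influence_incr; ring.
by rewrite !meanD mul1r.
Qed.

Lemma mean_influence x : E (influence x) = 0.
Proof.
rewrite /influence.
under eq_bigr do rewrite mulr_sumr.
rewrite exchange_big big1 //= => v _.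
transitivity (X x v * E (centred v)); last by rewrite mean_centred mulr0.
by rewrite mulr_sumr; apply: eq_bigr => w _; ring.
Qed.

Lemma mean_cross x : E (cross x) = 0.
Proof.
rewrite /cross; under eq_bigr do rewrite mulr_sumr.
rewrite exchange_big big1 //= => w _.
transitivity (pi w * influence x w * E (centred w)); last by rewrite mean_centred mulr0.
by rewrite mulr_sumr; apply: eq_bigr => v _; rewrite (centred_sym w v); ring.
Qed.

Lemma influence_bound x w : `|influence x w| <= 2 * sz x.
Proof.
apply: le_trans (ler_norm_sum _ _ _) _; rewrite /sz mulr_sumr.
apply: ler_sum => v _; rewrite normrM mulrC (ger0_norm (ler0n _ _)).
by apply: ler_wpM2r; [exact: ler0n | exact: centred_bound].
Qed.

(** The influence has mean zero, so in the second factor a function of v alone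
    may be dropped; what remains is bounded by 1 instead of 2. *)
Lemma crossE x v : cross x v = E (fun w => influence x w * dev v w).
Proof.
transitivity (E (fun w => influence x w * dev v w + (- (h v - q)) * influence x w)).
  by apply: eq_bigr => w _; rewrite centredE; ring.
by rewrite meanD mean_influence mulr0 addr0.
Qed.

Lemma cross_le x v : `|cross x v| <= E (fun w => `|influence x w|).
Proof.
rewrite crossE; apply: le_trans (ler_norm_sum _ _ _) _.
apply: ler_sum => w _; rewrite !normrM (ger0_norm (pi_ge0 w)).
apply: ler_wpM2l => //; rewrite -[leRHS]mulr1.
by apply: ler_wpM2l => //; rewrite ler_norml; exact: dev_bound.
Qed.

Lemma cross_bound x v : `|cross x v| <= 2 * sz x.
Proof.
apply: le_trans (cross_le x v) _.
rewrite -[leRHS]mean_cst; apply: mean_le => w; exact: influence_bound.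
Qed.

Lemma cross_sqr x v : cross x v ^+ 2 <= energy x.
Proof.
rewrite -[X in X <= _]ger0_norm ?sqr_ge0 // normrX.
apply: le_trans (_ : E (fun w => `|influence x w|) ^+ 2 <= _).
  rewrite ler_sqr ?nnegrE //; first exact: cross_le.
  by apply: sumr_ge0 => w _; exact: mulr_ge0.
apply: le_trans (mean_sqr _) _; apply: mean_le => w.
by rewrite real_normK ?num_real.
Qed.

(** One draw.  Given the past, the exponent is linear in the new kernel row,
    with mean zero, up to the variance term absorbed in t.  The bound
    e^l <= 1 + l + (5/6) l^2 turns the new randomness into a multiple of the
    energy, so the claim has the right form to be iterated. *)
Lemma chaos_step b t x : 0 <= b -> 0 <= t -> 2 * sz x * (b + 2 * t) <= 4 / 5 ->
  E (fun v => expR (- (b * chaos (incr x v)) + t * energy (incr x v))) <=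
  expR (t - b * chaos x + (t + 5 / 6 * (b + 2 * t) ^+ 2) * energy x).
Proof.
move=> b0 t0 hsz; set u := b + 2 * t.
pose l v := - (b * influence x v) + 2 * t * cross x v.
have sz0 : 0 <= sz x by apply: sumr_ge0.
have lb v : `|l v| <= 4 / 5.
  apply: le_trans hsz; rewrite /l.
  apply: le_trans (ler_normD _ _) _; rewrite normrN !normrM.
  rewrite (ger0_norm b0) (ger0_norm t0) (ger0_norm (ler0n _ 2)).
  have h1 := ler_wpM2l b0 (influence_bound x v).
  have h2 := ler_wpM2l t0 (cross_bound x v).
  lra.
have l1 : E l = 0.
  transitivity (E (fun v => (0 + (- b) * influence x v) + (2 * t) * cross x v)).
    by apply: eq_bigr => v _; rewrite /l; ring.
  by rewrite !meanD mean_influence mean_cross mean_cst; ring.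
have l2 : E (fun v => l v ^+ 2) <= u ^+ 2 * energy x.
  apply: le_trans (_ : E (fun v => (0 + (b ^+ 2 + 2 * b * t) * influence x v ^+ 2)
       + (2 * b * t + 4 * t ^+ 2) * energy x * 1) <= _).
    apply: mean_le => v; rewrite /l.
    have := cross_sqr x v; set C := cross x v; set S := influence x v; set N := energy x => CN.
    have k1 : 0 <= 2 * b * t + 4 * t ^+ 2.
      by rewrite addr_ge0 // !mulr_ge0 ?exprn_ge0.
    have := ler_wpM2l k1 CN.
    have bt0 : 0 <= b * t by exact: mulr_ge0.
    have := mulr_ge0 bt0 (sqr_ge0 (S + C)).
    lra.
  by rewrite !meanD !mean_cst -/(energy x) /u; rewrite le_eqVlt; apply/orP; left; apply/eqP; ring.
apply: le_trans (_ : E (fun v => expR (t - b * chaos x + t * energy x) * (1 + l v + 5 / 6 * l v ^+ 2)) <= _).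
  apply: mean_le => v; apply: le_trans (ler_wpM2l (expR_ge0 _) (expR_le_quad (lb v))).
  rewrite -expRD ler_expR chaos_incr energy_incr /l.
  have := ler_wpM2l t0 (centred_var v); lra.
have -> : E (fun v => expR (t - b * chaos x + t * energy x) * (1 + l v + 5 / 6 * l v ^+ 2)) =
   expR (t - b * chaos x + t * energy x) * (1 + 5 / 6 * E (fun v => l v ^+ 2)).
  transitivity (expR (t - b * chaos x + t * energy x) * E (fun v => (1 + 1 * l v) + 5 / 6 * l v ^+ 2)).
    by rewrite mulr_sumr; apply: eq_bigr => v _; ring.
  by rewrite meanD meanD mean_cst l1 mulr0 addr0.
have -> : t - b * chaos x + (t + 5 / 6 * u ^+ 2) * energy x =
  (t - b * chaos x + t * energy x) + 5 / 6 * (u ^+ 2 * energy x) by ring.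
rewrite [leRHS]expRD; apply: ler_wpM2l; first exact: expR_ge0.
apply: le_trans (expR_ge1Dx _).
by rewrite lerD2l; apply: ler_wpM2l; [lra | exact: l2].
Qed.

(** [th b r] is the coefficient of the energy when r draws remain.  With
    u = b + 2 th, [chaos_step] asks for u(r) + (5/3) u(r)^2 <= u(r+1), and
    1 / u(r) = 1 / b - (5/3) r is a solution in closed form. *)
Let u b (r : nat) : R := b / (1 - 5 / 3 * b * r%:R).
Let th b r := (u b r - b) / 2.

Lemma theta_step b r : 0 <= b -> b * r.+1%:R <= 2 / 5 ->
  0 <= th b r /\ th b r + 5 / 6 * (b + 2 * th b r) ^+ 2 <= th b r.+1.
Proof.
move=> b0; rewrite -[r.+1%:R]natr1 => br; rewrite /th.
have r0 : (0 : R) <= r%:R by exact: ler0n.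
have br0 : 0 <= b * r%:R by exact: mulr_ge0.
have d1 : 0 < 1 - 5 / 3 * b * r%:R by lra.
have d2 : 0 < 1 - 5 / 3 * b * r.+1%:R by rewrite -[r.+1%:R]natr1; lra.
have u1 : u b r * (1 - 5 / 3 * b * r%:R) = b by rewrite /u divfK ?gt_eqF.
have u2 : u b r.+1 * (1 - 5 / 3 * b * r.+1%:R) = b by rewrite /u divfK ?gt_eqF.
have u10 : 0 <= u b r by rewrite /u divr_ge0 // ltW.
have u20 : 0 <= u b r.+1 by rewrite /u divr_ge0 // ltW.
rewrite -[r.+1%:R]natr1 in u2 d2.
set v1 := u b r in u1 u10 *; set v2 := u b r.+1 in u2 u20 *.
have v1b : b <= v1.
  have : 0 <= v1 * (b * r%:R) by exact: mulr_ge0.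
  lra.
split; first lra.
have E1 : v2 - v1 = 5 / 3 * v1 * v2.
  have nz : (1 - 5 / 3 * b * r%:R) * (1 - 5 / 3 * b * (r%:R + 1)) != 0.
    by apply: mulf_neq0; rewrite gt_eqF.
  apply: (mulIf nz).
  transitivity ((v2 * (1 - 5 / 3 * b * (r%:R + 1))) * (1 - 5 / 3 * b * r%:R) -
      (v1 * (1 - 5 / 3 * b * r%:R)) * (1 - 5 / 3 * b * (r%:R + 1))); first by ring.
  transitivity (5 / 3 * (v1 * (1 - 5 / 3 * b * r%:R)) * (v2 * (1 - 5 / 3 * b * (r%:R + 1)))); last by ring.
  by rewrite u1 u2; field.
have v12 : 0 <= v1 * v2 by exact: mulr_ge0.
have : 0 <= v1 * (v2 - v1) by apply: mulr_ge0 => //; lra.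
lra.
Qed.

Lemma chaos_iter b r x : 0 <= b -> b * (sz x + r%:R) <= 2 / 5 ->
  isum pi r (fun y => expR (- (b * chaos y))) x <=
  expR (r%:R * th b r - b * chaos x + th b r * energy x).
Proof.
move=> b0; elim: r x => [|r IH] x hr /=.
  by rewrite mul0r sub0r /th /u mulr0 subr0 divr1 subrr mul0r mul0r addr0.
have sz0 : 0 <= sz x by apply: sumr_ge0.
have br : b * r.+1%:R <= 2 / 5.
  by apply: le_trans hr; apply: ler_wpM2l => //; rewrite lerDr.
have [th0 thS] := theta_step b0 br.
apply: le_trans (_ : E (fun v => expR (r%:R * th b r) * expR (- (b * chaos (incr x v)) + th b r * energy (incr x v))) <= _).
  apply: mean_le => v; rewrite -expRD addrA; apply: IH.
  by rewrite sz_incr -addrA [1 + _]addrC natr1.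
rewrite (eq_bigr (fun v => expR (r%:R * th b r) * (pi v * expR (- (b * chaos (incr x v)) + th b r * energy (incr x v)))));
  last by move=> v _; rewrite mulrCA.
rewrite -mulr_sumr.
have hsz : 2 * sz x * (b + 2 * th b r) <= 4 / 5.
  have -> : b + 2 * th b r = u b r by rewrite /th; field.
  rewrite /u mulrA ler_pdivrMr; rewrite -[r.+1%:R]natr1 in hr br; last first.
    have := mulr_ge0 b0 (ler0n R r); lra.
  have := mulr_ge0 b0 (ler0n R r); lra.
apply: le_trans (ler_wpM2l (expR_ge0 _) (chaos_step b0 th0 hsz)) _.
rewrite -expRD ler_expR.
have en0 : 0 <= energy x by apply: sumr_ge0 => w _; rewrite mulr_ge0 // sqr_ge0.
have h1 := ler_wpM2r en0 thS.
have thm : th b r <= th b r.+1.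
  apply: le_trans thS; rewrite lerDl; apply: mulr_ge0; [lra|exact: sqr_ge0].
have h2 := ler_wpM2l (ler0n R r.+1) thm; rewrite -![r.+1%:R]natr1 in h2 *; lra.
Qed.

(** Here th b k is multiplied by the k draws; with z = b k the exponent is
    (5/6) z^2 / (1 - (5/3) z), which is 2/5 at z = 2/5. *)
Lemma chaos_moment b (k : nat) : 0 <= b -> b * k%:R <= 2 / 5 ->
  isum pi k (fun y => expR (- (b * chaos y))) [ffun=> 0%N] <= expR (2 / 5).
Proof.
move=> b0 bk.
have X0 v : X [ffun=> 0%N] v = 0 by rewrite /X ffunE.
have sz0 : sz [ffun=> 0%N] = 0 by rewrite /sz big1.
apply: le_trans (chaos_iter b0 _) _; first by rewrite sz0 add0r.
have -> : chaos [ffun=> 0%N] = 0.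
  rewrite /chaos sz0 mul0r mulr0 mul0r /bil !big1 ?mulr0 ?addr0 ?subr0 // => v _;
  by rewrite X0 mul0r.
have -> : energy [ffun=> 0%N] = 0.
  rewrite /energy big1 // => v _; rewrite /influence big1 ?expr0n ?mulr0 // => w _.
  by rewrite X0 mul0r.
rewrite !mulr0 subr0 addr0 ler_expR.
have z0 : 0 <= b * k%:R by exact: mulr_ge0.
have d0 : 0 < 1 - 5 / 3 * (b * k%:R) by lra.
have -> : k%:R * th b k = 5 / 6 * (b * k%:R) ^+ 2 / (1 - 5 / 3 * (b * k%:R)).
  rewrite /th /u [5 / 3 * (b * _)]mulrA; rewrite mulrA in d0.
  set D := 1 - _ in d0 *; have Dn : D != 0 by rewrite gt_eqF.
  have e : 1 - D = 5 / 3 * b * k%:R by rewrite /D; ring.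
  transitivity (k%:R * b * (1 - D) / D / 2); first by field.
  by rewrite e; field.
rewrite ler_pdivrMr //.
have : 0 <= b * k%:R * (2 / 5 - b * k%:R) by apply: mulr_ge0; lra.
lra.
Qed.

End Chaos.

(** * The mean-field upper bound *)

Section MeanField.
Variables (R : realType) (V : finType) (H : V -> V -> R) (c : V -> R).
Variables (b eps : R) (k : nat) (rho : V -> R).
Hypothesis H_sym : forall v w, H v w = H w v.
Hypothesis H_01 : forall v w, 0 <= H v w <= 1.
Hypothesis H_diag : forall v, H v v = 0.
Hypothesis b_ge0 : 0 <= b.
Hypothesis bk : b * k%:R <= 2 / 5.
Hypothesis V_gt0 : (0 < #|V|)%N.

Let Z := \sum_v rho v.
Let pi v := rho v / Z.
Let y v := b * (c v + (k%:R - 1) * field H pi v).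

Hypothesis rho_lo : forall v, expR (- y v - eps) <= rho v.
Hypothesis rho_hi : forall v, rho v <= expR (- y v + eps).

Let rho_gt0 v : 0 < rho v.
Proof. exact: lt_le_trans (expR_gt0 _) (rho_lo v). Qed.

Let Z_gt0 : 0 < Z.
Proof.
have [v _] := card_gt0P V_gt0.
rewrite /Z (bigD1 v) //= ltr_pwDl //.
by apply: sumr_ge0 => w _; exact: ltW.
Qed.

Let pi_ge0 v : 0 <= pi v.
Proof. by rewrite divr_ge0 // ltW. Qed.

Let pi_sum : \sum_v pi v = 1.
Proof. by rewrite -mulr_suml mulfV // gt_eqF. Qed.

(** Changing the law of every draw by a factor e^y multiplies the integrand by
    the product of these factors. *)
Lemma isum_tilt j (Phi : {ffun V -> nat} -> R) x :
  isum (fun v => pi v * expR (y v)) j Phi x * expR (\sum_v (x v)%:R * y v) =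
  isum pi j (fun z => expR (\sum_v (z v)%:R * y v) * Phi z) x.
Proof.
elim: j x => [|j IH] x /=; first by rewrite mulrC.
rewrite mulr_suml; apply: eq_bigr => v _; rewrite -IH.
have -> : \sum_w ((incr x v) w)%:R * y w = \sum_w (x w)%:R * y w + y v.
  have := sum_ind y v => <-; rewrite -big_split /=; apply: eq_bigr => w _.
  by rewrite ffunE natrD mulrDl.
rewrite expRD; ring.
Qed.

Let q := \sum_v pi v * field H pi v.
Let C := \sum_v c v * pi v.

Let mean_y : \sum_v pi v * y v = b * (C + (k%:R - 1) * q).
Proof.
rewrite /C /q mulr_sumr -big_split /= mulr_sumr; apply: eq_bigr => v _.
rewrite /y; ring.
Qed.

(** The relative entropy of pi with respect to the uniform law is nonnegative. *)
Let mass_le : Z / #|V|%:R <= expR (eps - \sum_v pi v * y v).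
Proof.
have n0 : (0 : R) < #|V|%:R by rewrite ltr0n.
have J : expR (\sum_v pi v * (y v - eps)) <= #|V|%:R / Z.
  apply: le_trans (expR_jensen _ pi_ge0 pi_sum) _.
  have -> : #|V|%:R / Z = \sum_(v : V) Z^-1 by rewrite sumr_const mulr_natl.
  apply: ler_sum => v _.
  have -> : y v - eps = - (- y v + eps) by ring.
  rewrite expRN ler_pdivrMr ?expR_gt0 // /pi mulrC.
  by apply: ler_wpM2l; [rewrite invr_ge0 ltW | exact: rho_hi].
have -> : eps - \sum_v pi v * y v = - (\sum_v pi v * (y v - eps)).
  under [X in _ = - X]eq_bigr do rewrite mulrBr.
  by rewrite sumrB -mulr_suml pi_sum mul1r; ring.
rewrite expRN -[Z / _]invrK lef_pV2 ?posrE ?invr_gt0 ?divr_gt0 ?expR_gt0 //.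
by rewrite invf_div.
Qed.

(** The terms of the exponent that are linear in the sample cancel against
    the tilt y.  The chaos costs e^(2/5), each draw costs e^(2 eps) because rho
    is only approximately e^(-y), and b k / 2 is the difference between
    k (k - 1) and k^2 in the quadratic term. *)
Lemma mean_field_bound :
  ('C(#|V|, k)%:R : R)^-1 *
    \sum_(T : {set V} | #|T| == k) expR (- (b * quad H c (fun v => (v \in T)%:R)))
  <= expR (2 * k%:R * eps + 2^-1 * (b * k%:R) + 2 / 5
           - b * quad H c (fun v => k%:R * pi v)).
Proof.
have H0 v w : 0 <= H v w by case/andP: (H_01 v w).
have -> : \sum_(T : {set V} | #|T| == k) expR (- (b * quad H c (fun v => (v \in T)%:R)))
   = \sum_(T : {set V} | #|T| == k) gibbs H c b (ind T).
  apply: eq_bigr => T _; rewrite /gibbs; congr (expR (- (b * _))).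
  by apply: eq_quad => v; rewrite ffunE.
apply: le_trans (without_le_with_replacement c H0 H_diag b_ge0 k V_gt0) _.
have n0 : (0 : R) < #|V|%:R by rewrite ltr0n.
pose x0 : {ffun V -> nat} := [ffun=> 0%N].
pose D := b * (2^-1 * (k%:R * (k%:R - 1)) * q).
pose A := Z / #|V|%:R * expR eps.
have A0 : 0 <= A by rewrite mulr_ge0 ?expR_ge0 // divr_ge0 // ltW.
(* [A] is the price per draw of replacing the uniform law by the tilted one *)
have step1 : isum (fun=> #|V|%:R^-1) k (gibbs H c b) x0 <=
   A ^+ k * isum (fun v => pi v * expR (y v)) k (gibbs H c b) x0.
  have dom v : 0 <= (#|V|%:R^-1 : R) <= A * (pi v * expR (y v)).
    rewrite invr_ge0 ltW //= /A /pi.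
    have -> : Z / #|V|%:R * expR eps * (rho v / Z * expR (y v)) =
      #|V|%:R^-1 * (rho v * expR (y v + eps)).
      by rewrite expRD; field; rewrite !gt_eqF.
    rewrite -[X in X <= _]mulr1; apply: ler_wpM2l; first by rewrite invr_ge0 ltW.
    have -> : y v + eps = - (- y v - eps) by ring.
    by rewrite expRN ler_pdivlMr ?expR_gt0 // mul1r.
  have gg (z : {ffun V -> nat}) : (\sum_w z w = \sum_w x0 w + k)%N ->
     0 <= gibbs H c b z <= gibbs H c b z by rewrite lexx expR_ge0.
  have /andP[_ h] := ler_isum dom gg.
  by apply: le_trans h _; rewrite isum_scale.
apply: le_trans step1 _.
have step2 : isum (fun v => pi v * expR (y v)) k (gibbs H c b) x0 <=
    expR D * expR (2 / 5).
  have := isum_tilt k (gibbs H c b) x0.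
  rewrite [\sum_v _]big1 ?expR0 ?mulr1; last by move=> v _; rewrite ffunE mul0r.
  move=> ->.
  apply: le_trans (_ : isum pi k (fun z => expR D * expR (- (b * chaos H pi z))) x0 <= _).
    have pipi v : 0 <= pi v <= pi v by rewrite pi_ge0 lexx.
    have gg (z : {ffun V -> nat}) : (\sum_w z w = \sum_w x0 w + k)%N ->
       0 <= expR (\sum_v (z v)%:R * y v) * gibbs H c b z
         <= expR D * expR (- (b * chaos H pi z)).
      rewrite mulr_ge0 ?expR_ge0 //= [X in _ = (X + _)%N]big1; last by move=> v; rewrite ffunE.
      rewrite add0n => zk; rewrite -!expRD ler_expR le_eqVlt; apply/orP; left; apply/eqP.
      have szE : \sum_v (z v)%:R = k%:R :> R by rewrite -natr_sum zk.
      rewrite /chaos /quad szE /D -/q.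
      have -> : \sum_v (z v)%:R * y v = b * (\sum_v c v * (z v)%:R +
            (k%:R - 1) * \sum_v (z v)%:R * field H pi v).
        rewrite [in RHS]mulr_sumr -big_split /= mulr_sumr; apply: eq_bigr => v _.
        by rewrite /y; ring.
      ring.
    by have /andP[] := ler_isum pipi gg.
  rewrite isumZ; apply: ler_wpM2l; first exact: expR_ge0.
  exact: chaos_moment.
apply: le_trans (ler_wpM2l (exprn_ge0 _ A0) step2) _.
have Ale : A <= expR (2 * eps - b * (C + (k%:R - 1) * q)).
  rewrite -mean_y (_ : 2 * eps - _ = (eps - \sum_v pi v * y v) + eps); last by ring.
  by rewrite expRD; apply: ler_wpM2r mass_le; exact: expR_ge0.
have Ak : A ^+ k <= expR ((2 * eps - b * (C + (k%:R - 1) * q)) * k%:R).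
  by rewrite expRM_natr; apply: lerXn2r; rewrite ?nnegrE // expR_ge0.
apply: le_trans (ler_wpM2r _ Ak) _; first by rewrite mulr_ge0 ?expR_ge0.
rewrite -!expRD ler_expR.
have qE : quad H c (fun v => k%:R * pi v) = k%:R * C + 2^-1 * (k%:R ^+ 2 * q).
  rewrite /quad /bil /C /q !mulr_sumr; congr (_ + _).
    by apply: eq_bigr => v _; ring.
  apply: eq_bigr => v _; rewrite [field H (fun _ => _) v](_ : _ = k%:R * field H pi v).
    by ring.
  by rewrite /field mulr_sumr; apply: eq_bigr => w _; ring.
rewrite qE /D.
have /andP[q0 q1] : 0 <= q <= 1 by exact: bil_01.
have : 0 <= b * k%:R * (1 - q).
  by apply: mulr_ge0; [exact: mulr_ge0 | rewrite subr_ge0].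
lra.
Qed.

End MeanField.

(** * Convergence of the mean-field iteration *)

Section Contraction.
Variables (F : realFieldType) (V : finType) (H : V -> V -> F).
Variables (B k fl : F) (N : nat).
Hypothesis H_01 : forall v w, 0 <= H v w <= 1.
Hypothesis H_diag : forall v, H v v = 0.
Hypothesis B_ge0 : 0 <= B.
Hypothesis fl_ge0 : 0 <= fl.
Hypothesis B_small : B * (`|k - 1| + fl * (#|V|%:R - 1)) <= 9 / 25.
Hypothesis N_big : (64 <= N)%N.
Hypothesis V_gt0 : (0 < #|V|)%N.
Implicit Types (p y rho : V -> F).

(** The parameter fl is 0 for the set itself and 1 for its complement; in the
    latter case it subtracts the degree of v. *)
Definition exponent p v := B * \sum_w H v w * ((k - 1) * p w - fl).
Definition boltzmann y v := (1 - y v / N%:R) ^+ N.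
Definition normal rho v := rho v / \sum_w rho w.
Definition mf_step p := normal (boltzmann (exponent p)).

Lemma eq_exponent p p' : p =1 p' -> exponent p =1 exponent p'.
Proof.
by move=> e v; rewrite /exponent; congr (_ * _); apply: eq_bigr => w _; rewrite e.
Qed.

Lemma exponentE p v :
  exponent p v = B * ((k - 1) * field H p v - fl * \sum_w H v w).
Proof.
rewrite /exponent /field !mulr_sumr -sumrB mulr_sumr; apply: eq_bigr => w _; ring.
Qed.

Definition prob p := (forall v, 0 <= p v) /\ \sum_v p v = 1.

Lemma prob_field p v : prob p -> 0 <= field H p v <= 1.
Proof.
case=> p0 p1; apply/andP; split.
  by apply: sumr_ge0 => w _; case/andP: (H_01 v w) => ? _; exact: mulr_ge0.
rewrite -p1; apply: ler_sum => w _; case/andP: (H_01 v w) => ? ?.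
by rewrite ler_piMl.
Qed.

Lemma deg_bound v : 0 <= \sum_w H v w <= #|V|%:R - 1.
Proof.
apply/andP; split; first by apply: sumr_ge0 => w _; case/andP: (H_01 v w).
rewrite (bigD1 v) //= H_diag add0r.
apply: le_trans (_ : \sum_(w | w != v) 1 <= _).
  by apply: ler_sum => w _; case/andP: (H_01 v w).
rewrite sumr_const cardC1 -subn1 natrB //.
Qed.

Let kB : `|B * (k - 1)| <= 9 / 25.
Proof.
rewrite normrM (ger0_norm B_ge0); apply: le_trans B_small.
apply: ler_wpM2l => //; rewrite lerDl mulr_ge0 // subr_ge0 ler1n //.
Qed.

Lemma exponent_bound p v : prob p -> `|exponent p v| <= 9 / 25.
Proof.
move=> /(prob_field v)/andP[h0 h1]; have /andP[d0 d1] := deg_bound v.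
rewrite exponentE normrM (ger0_norm B_ge0).
apply: le_trans B_small; apply: ler_wpM2l => //.
apply: le_trans (ler_normB _ _) _; rewrite !normrM.
apply: lerD.
  by rewrite (ger0_norm h0) ler_piMr.
by rewrite (ger0_norm fl_ge0) (ger0_norm d0) ler_wpM2l.
Qed.

Lemma exponent_osc p v w : prob p -> `|exponent p v - exponent p w| <= 9 / 25.
Proof.
move=> pp; have /andP[h0 h1] := prob_field v pp; have /andP[g0 g1] := prob_field w pp.
have /andP[d0 d1] := deg_bound v; have /andP[e0 e1] := deg_bound w.
have -> : exponent p v - exponent p w =
  B * ((k - 1) * (field H p v - field H p w) - fl * (\sum_u H v u - \sum_u H w u)).
  by rewrite !exponentE; ring.
rewrite normrM (ger0_norm B_ge0).
apply: le_trans B_small; apply: ler_wpM2l => //.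
apply: le_trans (ler_normB _ _) _; rewrite !normrM.
apply: lerD.
  by rewrite ler_piMr // ler_norml; apply/andP; split; lra.
rewrite (ger0_norm fl_ge0) ler_wpM2l // ler_norml; apply/andP; split; lra.
Qed.

Let N0 : 0 < N%:R :> F.
Proof. by rewrite ltr0n; apply: leq_trans N_big. Qed.

Let N64 : 64 <= N%:R :> F.
Proof. by rewrite ler_nat. Qed.

Lemma factor_gt0 (a : F) : `|a| <= 9 / 25 -> 0 < 1 - a / N%:R.
Proof.
rewrite ler_norml => /andP[_ h]; rewrite subr_gt0 ltr_pdivrMr //; have := N64; lra.
Qed.

Lemma bernoulli (t : F) j : 0 <= t <= 1 -> 1 - j%:R * t <= (1 - t) ^+ j.
Proof.
case/andP=> t0 t1; elim: j => [|j IH]; first by rewrite mul0r subr0 expr0.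
rewrite exprS; have t1' : 0 <= 1 - t by lra.
apply: le_trans (ler_wpM2l t1' IH).
have : 0 <= j%:R * t * t by rewrite !mulr_ge0.
rewrite -natr1; lra.
Qed.

(** The constant 101/100 absorbs the correction N / (N - 9/25). *)
Lemma power_ratio (a a' d : F) : `|a| <= 9 / 25 -> `|a'| <= 9 / 25 ->
    `|a - a'| <= d -> d <= 9 / 25 ->
  (1 - 101 / 100 * d) * (1 - a' / N%:R) ^+ N <= (1 - a / N%:R) ^+ N.
Proof.
move=> ha ha' haa hd; have hN := N64.
have d0 : 0 <= d by apply: le_trans haa.
pose t := 101 / 100 * d / N%:R.
have t0 : 0 <= t by apply: divr_ge0; [lra | exact: ltW].
have t1 : t <= 1 by rewrite /t ler_pdivrMr //; lra.
have fa := factor_gt0 ha; have fa' := factor_gt0 ha'.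
have tN : N%:R * t = 101 / 100 * d by rewrite /t mulrC divfK ?gt_eqF.
rewrite -tN; apply: le_trans (ler_wpM2r (exprn_ge0 _ (ltW fa')) (bernoulli N _)) _.
  by rewrite t0.
rewrite -exprMn; apply: lerXn2r; rewrite ?nnegrE ?(ltW fa) //.
  by rewrite mulr_ge0 ?(ltW fa') // subr_ge0.
move: ha ha' haa; rewrite !ler_norml => /andP[a1 a2] /andP[a3 a4] /andP[a5 a6].
have aN : a = N%:R * (a / N%:R) by rewrite mulrC divfK ?gt_eqF.
have aN' : a' = N%:R * (a' / N%:R) by rewrite mulrC divfK ?gt_eqF.
rewrite -(ler_pM2l N0).
have -> : N%:R * (1 - a / N%:R) = N%:R - a by rewrite mulrBr mulr1 -aN.
have -> : N%:R * ((1 - t) * (1 - a' / N%:R)) = (1 - t) * (N%:R - a').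
  by rewrite mulrCA mulrBr mulr1 -aN'.
have : 0 <= t * (9 / 25 - a') by apply: mulr_ge0 => //; lra.
have : 0 <= t * (N%:R - 64) by apply: mulr_ge0 => //; lra.
have : 64 * t <= 101 / 100 * d.
  by rewrite -tN; apply: ler_wpM2r.
lra.
Qed.

Lemma normal_prob rho : (forall v, 0 < rho v) -> prob (normal rho).
Proof.
move=> r0.
have Z0 : 0 < \sum_w rho w.
  have [v _] := card_gt0P V_gt0; rewrite (bigD1 v) //= ltr_pwDl //.
  by apply: sumr_ge0 => w _; exact: ltW.
split=> [v|]; first by rewrite /normal divr_ge0 // ltW.
by rewrite /normal -mulr_suml mulfV // gt_eqF.
Qed.

Lemma field_normal rho v : field H (normal rho) v = field H rho v / \sum_w rho w.
Proof. by rewrite /field mulr_suml; apply: eq_bigr => w _; rewrite /normal mulrA. Qed.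

(** If two weightings agree up to the factor 1 - s, the normalised masses that
    they give to the same set differ by about s / 2, not s: the change
    of the mass x = X / (X + Y) involves the product X Y <= (X + Y)^2 / 4.  This
    gain keeps the rate in [mf_contract] below 1/2. *)
Lemma field_ratio rho rho' (s : F) v : 0 <= s -> s < 1 ->
    (forall w, 0 < rho w) -> (forall w, 0 < rho' w) ->
    (forall w, (1 - s) * rho w <= rho' w) -> (forall w, (1 - s) * rho' w <= rho w) ->
  field H (normal rho') v - field H (normal rho) v <= s / (2 * (1 - s) ^+ 2).
Proof.
move=> s0 s1 r0 r0' h1 h2; rewrite !field_normal.
pose G w := 1 - H v w.
have G0 w : 0 <= G w by rewrite /G subr_ge0; case/andP: (H_01 v w).
have H0 w : 0 <= H v w by case/andP: (H_01 v w).
pose Y (r : V -> F) := \sum_w G w * r w.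
have ZE r : \sum_w r w = field H r v + Y r.
  by rewrite -big_split /=; apply: eq_bigr => w _; rewrite /G; ring.
have gt0 (r : V -> F) : (forall w, 0 < r w) -> 0 < \sum_w r w.
  move=> rr; have [u _] := card_gt0P V_gt0; rewrite (bigD1 u) //= ltr_pwDl //.
  by apply: sumr_ge0 => w _; exact: ltW.
have := gt0 _ r0; have := gt0 _ r0'; rewrite !ZE.
have scale (K : V -> F) r r' : (forall w, 0 <= K w) -> (forall w, (1 - s) * r w <= r' w) ->
   (1 - s) * (\sum_w K w * r w) <= \sum_w K w * r' w.
  move=> K0 hh; rewrite mulr_sumr; apply: ler_sum => w _.
  by rewrite mulrCA; apply: ler_wpM2l.
have x1 := scale _ _ _ H0 h1; have x2 := scale _ _ _ H0 h2.
have y1 := scale _ _ _ G0 h1; have y2 := scale _ _ _ G0 h2.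
rewrite -!/(field _ _ _) in x1 x2; rewrite -!/(Y _) in y1 y2.
have x0 : 0 <= field H rho v by apply: sumr_ge0 => w _; rewrite mulr_ge0 // ltW.
have x0' : 0 <= field H rho' v by apply: sumr_ge0 => w _; rewrite mulr_ge0 // ltW.
have y0 : 0 <= Y rho by apply: sumr_ge0 => w _; rewrite mulr_ge0 // ltW.
have y0' : 0 <= Y rho' by apply: sumr_ge0 => w _; rewrite mulr_ge0 // ltW.
move: x0 x0' y0 y0' x1 x2 y1 y2.
move: (field H rho v) (field H rho' v) (Y rho) (Y rho') => x x' z z' x0 x0' y0 y0' x1 x2 y1 y2 Z0' Z0.
have u0 : 0 < 1 - s by lra.
have -> : x' / (x' + z') - x / (x + z) = (x' * z - x * z') / ((x' + z') * (x + z)).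
  by field; rewrite !gt_eqF.
have d0 : 0 < 2 * (1 - s) ^+ 2 by rewrite mulr_gt0 // exprn_gt0.
rewrite ler_pdivrMr ?mulr_gt0 // mulrAC ler_pdivlMr //.
have a1 : (1 - s) * (x' * z - x * z') <= x * z * (2 * s - s ^+ 2).
  have := ler_wpM2r y0 x2; have := ler_wpM2l (ltW u0) (ler_wpM2l x0 y1); lra.
have a2 : (1 - s) * (x + z) <= x' + z' by lra.
have a3 : s * (1 - s) * (x + z) ^+ 2 <= s * ((x' + z') * (x + z)).
  have := ler_wpM2r (ltW Z0) a2; move=> /(ler_wpM2l s0); lra.
have a4 : 0 <= s * (x - z) ^+ 2 by apply: mulr_ge0 => //; exact: sqr_ge0.
have a5 := ler_wpM2l (ltW u0) a4.
have a6 := ler_wpM2l (ltW u0) a1.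
have a7 : 0 <= (1 - s) * (x * z * s ^+ 2).
  by apply: mulr_ge0; [exact: ltW | rewrite mulr_ge0 ?exprn_ge0 // mulr_ge0].
lra.
Qed.

Lemma boltzmann_gt0 y : (forall v, `|y v| <= 9 / 25) -> forall v, 0 < boltzmann y v.
Proof. by move=> h v; rewrite exprn_gt0 // factor_gt0. Qed.

Lemma mf_step_prob p : prob p -> prob (mf_step p).
Proof.
by move=> pp; apply/normal_prob/boltzmann_gt0 => v; exact: exponent_bound.
Qed.

(** A change d of the exponents changes the weights by the factor 1 - s with
    s = (101/100) d <= 0.3636, hence the fields by at most s / (2 (1 - s)^2), and
    the new exponents by 9/25 times as much, which is below d / 2. *)
Lemma mf_contract p p' (d : F) : prob p -> prob p' -> d <= 9 / 25 ->
    (forall v, `|exponent p' v - exponent p v| <= d) ->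
  forall v, `|exponent (mf_step p') v - exponent (mf_step p) v| <= d / 2.
Proof.
move=> pp pp' hd h v.
have d0 : 0 <= d by apply: le_trans (h v).
have bd q w : prob q -> `|exponent q w| <= 9 / 25 by exact: exponent_bound.
pose s := 101 / 100 * d.
have s0 : 0 <= s by rewrite /s; lra.
have s1 : s < 1 by rewrite /s; lra.
have r0 : forall w, 0 < boltzmann (exponent p) w by apply: boltzmann_gt0 => w; exact: bd.
have r0' : forall w, 0 < boltzmann (exponent p') w by apply: boltzmann_gt0 => w; exact: bd.
have r1 w : (1 - s) * boltzmann (exponent p) w <= boltzmann (exponent p') w.
  by apply: power_ratio => //; exact: bd.
have r2 w : (1 - s) * boltzmann (exponent p') w <= boltzmann (exponent p) w.
  by apply: power_ratio => //; rewrite ?bd // distrC.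
have f1 := field_ratio v s0 s1 r0 r0' r1 r2.
have f2 := field_ratio v s0 s1 r0' r0 r2 r1.
set Q := s / _ in f1 f2.
have QE : Q * (2 * (1 - s) ^+ 2) = s by rewrite /Q divfK // gt_eqF // mulr_gt0 // exprn_gt0 // subr_gt0.
have Q0 : 0 <= Q by apply: divr_ge0 => //; apply: mulr_ge0 => //; exact: sqr_ge0.
have -> : exponent (mf_step p') v - exponent (mf_step p) v =
   B * (k - 1) * (field H (mf_step p') v - field H (mf_step p) v).
  by rewrite !exponentE; ring.
rewrite normrM.
have fQ : `|field H (mf_step p') v - field H (mf_step p) v| <= Q.
  by rewrite ler_norml; apply/andP; split; rewrite /mf_step; lra.
apply: le_trans (ler_pM (normr_ge0 _) (normr_ge0 _) kB fQ) _.
have sq : (81 / 200 : F) <= (1 - s) ^+ 2.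
  have : (6364 / 10000) ^+ 2 <= (1 - s) ^+ 2.
    by apply: lerXn2r; rewrite ?nnegrE /s; lra.
  lra.
have : Q * (81 / 100) <= s.
  by rewrite -QE; apply: ler_wpM2l => //; lra.
rewrite /s; lra.
Qed.

Lemma mf_converge p t : prob p ->
  let q := iter t mf_step p in
  prob q /\ forall v, `|exponent (mf_step q) v - exponent q v| <= 9 / 25 / 2 ^+ t.
Proof.
move=> pp; elim: t => [|t [IH1 IH2]] /=.
  split=> // v; rewrite expr0 divr1.
  have -> : exponent (mf_step p) v - exponent p v =
     B * (k - 1) * (field H (mf_step p) v - field H p v).
    by rewrite !exponentE; ring.
  rewrite normrM; apply: le_trans kB; rewrite ler_piMr // ler_norml.
  have /andP[? ?] := prob_field v pp.
  have /andP[? ?] := prob_field v (mf_step_prob pp).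
  by apply/andP; split; lra.
have IH3 := mf_step_prob IH1; split=> // v.
have e0 : (0 : F) < 2 ^+ t by exact: exprn_gt0.
have := mf_contract IH1 IH3 _ IH2 v.
rewrite exprSr invfM mulrA; apply.
by rewrite ler_pdivrMr // ler_peMr //; [lra | rewrite exprn_ege1 // ler1n].
Qed.

(** All exponents lie in an interval of length 9/25, so no weight exceeds twice
    another one. *)
Lemma normal_spread p v : prob p -> #|V|%:R * mf_step p v <= 2.
Proof.
move=> pp; rewrite /mf_step /normal; set rho := boltzmann _.
have r0 : forall w, 0 < rho w by apply: boltzmann_gt0 => w; exact: exponent_bound.
have Z0 : 0 < \sum_w rho w.
  rewrite (bigD1 v) //= ltr_pwDl //.
  by apply: sumr_ge0 => w _; exact: ltW.
rewrite mulrA ler_pdivrMr // mulr_sumr mulr_natl -sumr_const.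
apply: ler_sum => w _.
have := @power_ratio (exponent p w) (exponent p v) (9 / 25) (exponent_bound w pp)
  (exponent_bound v pp) (exponent_osc w v pp) (lexx _).
rewrite -!/(boltzmann _ _) -/rho; have := r0 v; lra.
Qed.

End Contraction.

(** * Rounding by transfers of mass *)

Section Rounding.
Variables (F : realFieldType) (V : finType) (H : V -> V -> F).
Hypothesis H_sym : forall v w, H v w = H w v.
Hypothesis H_01 : forall v w, 0 <= H v w <= 1.
Hypothesis H_diag : forall v, H v v = 0.
Implicit Types (p : V -> F).

Definition setp p i (a : F) v := if v == i then a else p v.

Lemma transfer_sum p i j a : i != j ->
  \sum_v setp (setp p i a) j (p i + p j - a) v = \sum_v p v.
Proof.
move=> ij; rewrite [LHS](bigD1 j) // [in RHS](bigD1 j) //= [in LHS](bigD1 i) //= [in RHS](bigD1 i) //=.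
rewrite /setp !eqxx (negPf ij).
rewrite (eq_bigr p); first by ring.
by move=> v /andP[/negPf-> /negPf->].
Qed.

Lemma transfer_bil p i j a : i != j ->
    (a - p i) * (field H p i - field H p j) <= 0 ->
  bil H (setp (setp p i a) j (p i + p j - a)) (setp (setp p i a) j (p i + p j - a))
  <= bil H p p.
Proof.
move=> ij hD; set p' := setp _ _ _.
pose d v : F := 1 * ((v == i)%:R - (v == j)%:R).
have p'E : p' =1 (fun v => p v + (a - p i) * d v).
  move=> v; rewrite /p' /setp /d.
  case: (eqVneq v j) => [->|nj].
    by rewrite eq_sym (negPf ij) /=; ring.
  by case: (eqVneq v i) => [->|ni] /=; ring.
rewrite (eq_bil _ p'E p'E) bil_linl !bil_linr.
have H0 v w : 0 <= H v w by case/andP: (H_01 v w).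
have dd : bil H d d <= 0 by exact: (@bil_transfer _ _ _ H0 H_diag 1 i j).
have sumd (f : V -> F) : \sum_v d v * f v = f i - f j.
  rewrite /d; under eq_bigr do rewrite mul1r mulrBl.
  by rewrite sumrB !sum_ind.
have dp : bil H d p = field H p i - field H p j by rewrite /bil sumd.
have pd : bil H p d = bil H d p.
  rewrite /bil /field; under eq_bigr do rewrite mulr_sumr.
  rewrite exchange_big /=; apply: eq_bigr => v _; rewrite mulr_sumr.
  by apply: eq_bigr => w _; rewrite H_sym; ring.
rewrite pd dp.
have : 0 <= (a - p i) ^+ 2 * - bil H d d by apply: mulr_ge0; rewrite ?sqr_ge0 ?oppr_ge0.
lra.
Qed.

(** The new value of coordinate i when all the mass that fits is moved between i
    and j, in the direction in which the gradient does not increase h. *)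
Definition shift_to p i j : F :=
  if field H p i - field H p j <= 0 then
    (if p i + p j <= 1 then p i + p j else 1)
  else (if p i + p j <= 1 then 0 else p i + p j - 1).

Lemma shift_to_spec p i j :
    0 <= p i <= 1 -> 0 <= p j <= 1 ->
  let a := shift_to p i j in let a' := p i + p j - a in
  [/\ (a - p i) * (field H p i - field H p j) <= 0,
      0 <= a <= 1, 0 <= a' <= 1 &
      (a == 0) || (a == 1) || (a' == 0) || (a' == 1)].
Proof.
move=> /andP[i0 i1] /andP[j0 j1] /=; rewrite /shift_to.
case: (lerP (field H p i - field H p j) 0) => hD; case: (lerP (p i + p j) 1) => hs.
- split; [|by apply/andP; split; lra|by apply/andP; split; lra|].
    by apply: mulr_ge0_le0 => //; lra.
  by rewrite subrr eqxx !orbT.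
- split; [|by apply/andP; split; lra|by apply/andP; split; lra|].
    by apply: mulr_ge0_le0 => //; lra.
  by rewrite eqxx !orbT.
- split; [|by apply/andP; split; lra|by apply/andP; split; lra|].
    by apply: mulr_le0_ge0; lra.
  by rewrite eqxx.
- split; [|by apply/andP; split; lra|by apply/andP; split; lra|].
    by apply: mulr_le0_ge0; lra.
  by rewrite (_ : p i + p j - (p i + p j - 1) = 1) ?eqxx ?orbT //; ring.
Qed.

End Rounding.

(** * Non-adjacent pairs, densities and weights *)

Lemma natr_bin2 (F : realFieldType) (j : nat) :
  'C(j, 2)%:R = 2^-1 * (j%:R * (j%:R - 1)) :> F.
Proof.
have := mul_bin_diag j 1; rewrite bin1 => h.
have h2 : (j%:R * j.-1%:R = 2 * 'C(j, 2)%:R :> F) by rewrite -!natrM h.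
case: j {h} h2 => [|j] h2; first by rewrite bin0n mul0r mulr0.
by rewrite -[X in X - 1]natr1 addrK h2; field.
Qed.

Section NonAdjacency.
Variables (n : nat) (G : sgraph n).

(** Every edge inside S is counted once in each direction. *)
Lemma count_edges (S : {set 'I_n}) :
  (#|[set A in edges G | A \subset S]| * 2 =
   \sum_(u in S) \sum_(v in S) G u v)%N.
Proof.
pose P := [pred p : 'I_n * 'I_n | [&& p.1 \in S, p.2 \in S & G p.1 p.2]].
pose f (p : 'I_n * 'I_n) := [set p.1; p.2].
transitivity (\sum_(p | P p) 1)%N; last first.
  rewrite (pair_big (mem S) (mem S) (fun u v => G u v : nat)) /=.
  rewrite [RHS](bigID (fun p : 'I_n * 'I_n => G p.1 p.2)) /= [X in (_ + X)%N]big1 ?addn0.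
    by apply: eq_big => [p|p /and3P[_ _ ->]] //=; rewrite andbA.
  by move=> p /andP[_ /negPf->].
rewrite (partition_big f (mem [set A in edges G | A \subset S])) /=; last first.
  move=> p /and3P[p1 p2 Gp]; rewrite inE; apply/andP; split.
    by apply/imsetP; exists p; rewrite ?inE.
  by rewrite subUset !sub1set p1.
rewrite -sum_nat_const; apply: eq_bigr => A; rewrite inE => /andP[/imsetP[[a b] Gab ->] /= sub].
rewrite inE /= in Gab.
have ab : a != b by apply/eqP => ab; move: Gab; rewrite ab adj_irr.
move: sub; rewrite subUset !sub1set => /andP[aS bS].
rewrite sum1_card -(_ : #|[set (a, b); (b, a)]| = 2)%N; last first.
  by rewrite cards2 xpair_eqE (negPf ab).
apply: eq_card => -[u v]; rewrite !inE /= !xpair_eqE unfold_in /= /f /=.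
apply/orP/andP => [[/andP[/eqP-> /eqP->]|/andP[/eqP-> /eqP->]]|[/and3P[_ _ Guv] /eqP e]].
- by rewrite aS bS Gab eqxx.
- by rewrite aS bS adj_sym Gab setUC eqxx.
have uv : u != v by apply/eqP => uv; move: Guv; rewrite uv adj_irr.
have : u \in [set a; b] by rewrite -e !inE eqxx.
have : v \in [set a; b] by rewrite -e !inE eqxx orbT.
rewrite !inE => /orP[]/eqP vE /orP[]/eqP uE; move: uv; rewrite vE uE ?eqxx // => _.
  by right; rewrite ?eqxx.
by left; rewrite ?eqxx.
Qed.

Section Field.
Variable F : realFieldType.

Definition nonadj (v w : 'I_n) : F := ((v != w) && ~~ G v w)%:R.

Lemma nonadj_sym v w : nonadj v w = nonadj w v.
Proof. by rewrite /nonadj eq_sym adj_sym. Qed.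

Lemma nonadj_01 v w : 0 <= nonadj v w <= 1.
Proof. by rewrite /nonadj ler0n lern1 leq_b1. Qed.

Lemma nonadj_diag v : nonadj v v = 0.
Proof. by rewrite /nonadj eqxx. Qed.

Definition nonedges (x : 'I_n -> F) : F := 2^-1 * bil nonadj x x.

Definition indic (S : {set 'I_n}) (v : 'I_n) : F := (v \in S)%:R.

Lemma nonedges_count (S : {set 'I_n}) :
  #|[set A in edges G | A \subset S]|%:R + nonedges (indic S) = 'C(#|S|, 2)%:R :> F.
Proof.
have edE : #|[set A in edges G | A \subset S]|%:R =
   2^-1 * \sum_u \sum_v indic S u * indic S v * (G u v)%:R :> F.
  suff <- : (#|[set A in edges G | A \subset S]| * 2)%:R =
     \sum_u \sum_v indic S u * indic S v * (G u v)%:R :> F by rewrite natrM; field.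
  rewrite count_edges natr_sum big_mkcond /=; apply: eq_bigr => u _.
  rewrite /indic; case: (u \in S); last by rewrite big1 // => v _; rewrite !mul0r.
  rewrite natr_sum big_mkcond /=; apply: eq_bigr => v _.
  by case: (v \in S); rewrite !(mul0r, mul1r).
have szE : \sum_u indic S u = #|S|%:R.
  by rewrite -natr_sum -big_mkcond /= sum1_card.
have diagE : \sum_u \sum_v indic S u * indic S v * (u == v)%:R = #|S|%:R.
  rewrite -szE; apply: eq_bigr => u _.
  transitivity (\sum_v (v == u)%:R * (indic S u * indic S v)).
    by apply: eq_bigr => v _; rewrite eq_sym mulrC.
  by rewrite sum_ind /indic; case: (u \in S); rewrite ?mulr0 ?mulr1.
have allE : \sum_u \sum_v indic S u * indic S v = #|S|%:R * #|S|%:R.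
  by rewrite -szE mulr_suml; apply: eq_bigr => u _; rewrite mulr_sumr.
have nonE : bil nonadj (indic S) (indic S) =
   \sum_u \sum_v (indic S u * indic S v - indic S u * indic S v * (u == v)%:R
                  - indic S u * indic S v * (G u v)%:R).
  rewrite /bil /field; apply: eq_bigr => u _; rewrite mulr_sumr.
  apply: eq_bigr => v _; rewrite /nonadj.
  case: eqVneq => [<-|_]; first by rewrite adj_irr /=; ring.
  by case: (G u v) => /=; ring.
rewrite /nonedges nonE edE natr_bin2.
under [X in _ + 2^-1 * X]eq_bigr do rewrite !sumrB.
by rewrite !sumrB allE diagE; ring.
Qed.

Lemma nonedges_ge0 (S : {set 'I_n}) : 0 <= nonedges (indic S).
Proof.
rewrite /nonedges mulr_ge0 ?invr_ge0 //; apply: sumr_ge0 => u _.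
rewrite mulr_ge0 ?ler0n //; apply: sumr_ge0 => v _.
by rewrite mulr_ge0 ?ler0n.
Qed.

Definition flip (fl : bool) (x : F) : F := if fl then 1 - x else x.

Definition flip_lin (fl : bool) (v : 'I_n) : F :=
  if fl then - \sum_w nonadj v w else 0.

(** Complementing a vertex set keeps the quadratic part and adds a linear term
    given by the degrees. *)
Lemma nonedges_flip (fl : bool) (x : 'I_n -> F) :
  nonedges (fun v => flip fl (x v)) =
  (if fl then nonedges (fun=> 1) else 0) + quad nonadj (flip_lin fl) x.
Proof.
case: fl; rewrite /flip /flip_lin /nonedges /quad; last first.
  by rewrite big1 ?add0r // => v _; rewrite mul0r.
have e : (fun v => 1 - x v) =1 (fun v => (fun=> 1) v + (-1) * x v) by move=> v; ring.
rewrite (eq_bil _ e e) bil_linl !bil_linr.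
have b1 : bil nonadj x (fun=> 1) = \sum_v x v * \sum_w nonadj v w.
  by apply: eq_bigr => v _; congr (_ * _); apply: eq_bigr => w _; rewrite mulr1.
have b2 : bil nonadj (fun=> 1) x = bil nonadj x (fun=> 1).
  rewrite b1 /bil /field; under eq_bigr do rewrite mul1r.
  rewrite exchange_big /=; apply: eq_bigr => v _.
  under eq_bigr do rewrite nonadj_sym mulrC.
  by rewrite mulr_sumr.
rewrite b2 b1.
have -> : \sum_v - (\sum_w nonadj v w) * x v = - \sum_v x v * \sum_w nonadj v w.
  by rewrite -sumrN; apply: eq_bigr => v _; ring.
by field.
Qed.

End Field.
End NonAdjacency.

Section Morph.
Variables (R : realType) (n : nat) (G : sgraph n).
Local Notation phi := (@ratr R).

Lemma ratr_nonadj v w : phi (nonadj G rat v w) = nonadj G R v w.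
Proof. by rewrite /nonadj ratr_nat. Qed.

Lemma ratr_field (x : 'I_n -> rat) v :
  phi (field (nonadj G rat) x v) = field (nonadj G R) (fun w => phi (x w)) v.
Proof.
rewrite /field rmorph_sum; apply: eq_bigr => w _.
by rewrite /= rmorphM /= ratr_nonadj.
Qed.

Lemma ratr_nonedges (x : 'I_n -> rat) :
  phi (nonedges G x) = nonedges G (fun w => phi (x w)).
Proof.
rewrite /nonedges rmorphM /= fmorphV /= ratr_nat /bil rmorph_sum; congr (_ * _).
by apply: eq_bigr => w _; rewrite /= rmorphM /= ratr_field.
Qed.

End Morph.

Section Weights.
Variables (R : realType) (n m : nat) (G : sgraph n) (g : R).
Hypothesis m_gt1 : (1 < m)%N.
Hypothesis g0 : 0 < g.
Let x := g / (m%:R - 1).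
Hypothesis x_small : x * m%:R <= 1 / 5.

Let m1_gt0 : 0 < m%:R - 1 :> R.
Proof. by rewrite subr_gt0 ltr1n. Qed.

Let x0 : 0 <= x. Proof. by rewrite divr_ge0 // ltW. Qed.

Let bin_gt0' : 0 < 'C(m, 2)%:R :> R.
Proof. by rewrite ltr0n bin_gt0. Qed.

Lemma sigmaE (S : {set 'I_n}) : #|S| = m ->
  (sigma R G S - 1) * 'C(m, 2)%:R = - nonedges G (indic R S).
Proof.
move=> Sm; rewrite /sigma Sm mulrBl mul1r divfK ?gt_eqF //.
by have := nonedges_count G R S; rewrite Sm => <-; ring.
Qed.

(** With x = g / (m - 1) the density enters the objective through 2 x per
    non-adjacent pair. *)
Lemma objectiveE (S : {set 'I_n}) : #|S| = m ->
  g * m%:R * sigma R G S = g * m%:R - 2 * x * nonedges G (indic R S).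
Proof.
move=> Sm; rewrite -[nonedges _ _]opprK -(sigmaE Sm).
have e : 2 * x * 'C(m, 2)%:R = g * m%:R.
  by rewrite natr_bin2 /x; field; rewrite gt_eqF.
transitivity (g * m%:R + 2 * x * 'C(m, 2)%:R * (sigma R G S - 1)); last by ring.
by rewrite e; ring.
Qed.

(** A non-adjacent pair costs (1 - x) / (1 + x) <= exp(- 2 x + x^2).  There are
    at most m^2 / 2 pairs and x m <= 1/5, so the terms x^2 add up to at most
    1/50. *)
Lemma weight_le (S : {set 'I_n}) : #|S| = m ->
  weight g m G S <= expR (g * m%:R + 2 / 100 - 2 * x * nonedges G (indic R S)).
Proof.
move=> Sm; rewrite /weight -/x -(opprB (sigma R G S) 1) mulNr !(sigmaE Sm) opprK.
set h := nonedges _ _.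
have h0 : 0 <= h by exact: nonedges_ge0.
have hx0 := x0; have hx := x_small.
have hm : h <= 2^-1 * m%:R ^+ 2.
  have := nonedges_count G R S; rewrite Sm natr_bin2 -/h.
  have := ler0n R #|[set A in edges G | A \subset S]|; have := ler0n R m; lra.
have m2 : (2 : R) <= m%:R by rewrite ler_nat.
have x1 : x < 1.
  have m20 : 0 <= m%:R - 2 :> R by lra.
  have := mulr_ge0 x0 m20; lra.
have -> : (1 + x) `^ (- h) = expR (- h * ln (1 + x)).
  by rewrite /powR gt_eqF //; lra.
have -> : (1 - x) `^ h = expR (h * ln (1 - x)).
  by rewrite /powR gt_eqF //; lra.
rewrite -!expRD ler_expR.
have l1 : x - x ^+ 2 <= ln (1 + x).
  have p1 : 1 + x \is Num.pos by rewrite posrE; lra.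
  by rewrite -ler_expR (lnK p1); exact: expR_le_one_add.
have l2 : ln (1 - x) <= - x.
  have p1 : 1 - x \is Num.pos by rewrite posrE; lra.
  by rewrite -ler_expR (lnK p1); exact: expR_ge1Dx.
have k1 := ler_wpM2l h0 l1; have k2 := ler_wpM2l h0 l2.
have k3 : x ^+ 2 * h <= x ^+ 2 * (2^-1 * m%:R ^+ 2).
  by apply: ler_wpM2l => //; exact: sqr_ge0.
have k4 : (x * m%:R) ^+ 2 <= (1 / 5) ^+ 2.
  have xm0 : 0 <= x * m%:R by apply: mulr_ge0.
  by apply: lerXn2r; rewrite ?nnegrE //; lra.
lra.
Qed.

End Weights.

(** * The quality of the mean-field point *)

(** The relative error of (1 - a / N)^N as an approximation of e^(-a) is
    O(a^2 / N). *)
Lemma power_expR (R : realType) (a : R) (N : nat) : `|a| <= 9 / 25 -> (64 <= N)%N ->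
  expR (- a - 2 * a ^+ 2 / N%:R) <= (1 - a / N%:R) ^+ N <= expR (- a).
Proof.
move=> ha hN; have N64 : 64 <= N%:R :> R by rewrite ler_nat.
have N0 : 0 < N%:R :> R by lra.
have Nn : N%:R != 0 :> R by rewrite gt_eqF.
have z2 : `|a / N%:R| <= 1 / 2.
  have i0 : 0 <= N%:R^-1 :> R by rewrite invr_ge0 ltW.
  by rewrite normrM (ger0_norm i0) ler_pdivrMr //; lra.
have z0 : 0 <= 1 - a / N%:R by move: z2; rewrite ler_norml => /andP[? ?]; lra.
have -> : - a - 2 * a ^+ 2 / N%:R = (- (a / N%:R) - 2 * (a / N%:R) ^+ 2) * N%:R by field.
have -> : - a = (- (a / N%:R)) * N%:R by field.
rewrite !expRM_natr; apply/andP; split; apply: lerXn2r; rewrite ?nnegrE ?expR_ge0 //.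
  exact: one_sub_ge_expR.
exact: expR_ge1Dx.
Qed.

Lemma pow2_big (F : realFieldType) (n : nat) : (0 < n)%N ->
  9 / 25 / 2 ^+ (128 * n).-1 <= (256 * n%:R)^-1 :> F.
Proof.
move=> n0.
have e0 : (0 : F) < 2 ^+ (128 * n).-1 by exact: exprn_gt0.
have n0' : (0 : F) < 256 * n%:R by rewrite mulr_gt0 // ltr0n.
rewrite ler_pdivrMr // -(ler_pM2l n0') mulVKf ?gt_eqF //.
have h : (256 * n <= 2 ^ (128 * n).-1)%N.
  have -> : ((128 * n).-1 = 8 + (128 * n - 9))%N by lia.
  rewrite expnD leq_mul //.
  have := ltn_expl (128 * n - 9) (isT : 1 < 2)%N; lia.
have : 256 * n%:R <= 2 ^+ (128 * n).-1 :> F by rewrite -natrM -natrX ler_nat.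
lra.
Qed.

Section Correctness.
Variables (R : realType) (n m : nat) (G : sgraph n) (g : rat) (fl : bool).
Hypothesis m_gt1 : (1 < m)%N.
Hypothesis m_le_n : (m <= n)%N.
Hypothesis g_gt0 : 0 < g.
Hypothesis g_small : g / (m%:R - 1) * m%:R <= 1 / 5.

Let k := if fl then (n - m)%N else m.
Let B : rat := 2 * g / (m%:R - 1).
(** With N = 128 n, both the error of (1 - y / N)^N and the residual of
    the fixed-point equation after N rounds are at most 1 / (256 n) on the
    exponents.
    Multiplied by 2 k <= n draws, this stays below 1/50. *)
Let N := (128 * n)%N.

Hypothesis B_small : B * (`|k%:R - 1| + fl%:R * (n%:R - 1)) <= 9 / 25.
Hypothesis k_half : (2 * k <= n)%N.

Definition mf_point : 'I_n -> rat :=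
  iter N (mf_step (nonadj G rat) B k%:R fl%:R N) (fun=> n%:R^-1).

Definition mf_marginal v := flip fl (k%:R * mf_point v).

Let n_gt0 : (0 < n)%N. Proof. exact: leq_trans (ltnW m_gt1) m_le_n. Qed.
Let V_gt0 : (0 < #|'I_n|)%N. Proof. by rewrite card_ord. Qed.
Let N_big : (64 <= N)%N. Proof. rewrite /N; lia. Qed.
Let m1_gt0 : 0 < m%:R - 1 :> rat. Proof. by rewrite subr_gt0 ltr1n. Qed.
Let B_ge0 : 0 <= B. Proof. by apply: divr_ge0; [apply: mulr_ge0 => //; exact: ltW | exact: ltW]. Qed.
Let fl_ge0 : 0 <= fl%:R :> rat. Proof. exact: ler0n. Qed.
Let B_small' : B * (`|k%:R - 1| + fl%:R * (#|'I_n|%:R - 1)) <= 9 / 25.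
Proof. by rewrite card_ord. Qed.

Let Hr := nonadj G rat.
Let q := iter N.-1 (mf_step Hr B k%:R fl%:R N) (fun=> n%:R^-1).

Let mf_pointE : mf_point = mf_step Hr B k%:R fl%:R N q.
Proof.
have it j (f : ('I_n -> rat) -> 'I_n -> rat) x :
  (0 < j)%N -> iter j f x = f (iter j.-1 f x) by case: j.
by apply: it; exact: leq_trans N_big.
Qed.

Let unif_prob : prob (fun=> n%:R^-1 : rat) (V := 'I_n).
Proof.
split=> [v|]; first by rewrite invr_ge0 ler0n.
by rewrite sumr_const card_ord -[_ *+ _]mulr_natl mulfV // pnatr_eq0 -lt0n.
Qed.

Let conv := mf_converge (nonadj_01 G rat) (@nonadj_diag n G rat) B_ge0 fl_ge0
  B_small' N_big V_gt0 N.-1 unif_prob.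

Let q_prob : prob q. Proof. by case: conv. Qed.

Let mf_prob : prob mf_point.
Proof.
rewrite mf_pointE; exact: (mf_step_prob (nonadj_01 G rat) (@nonadj_diag n G rat) B_ge0 fl_ge0
  B_small' N_big V_gt0).
Qed.

(** pi is at most 2 / n by [normal_spread], and 2 k <= n. *)
Lemma mf_marginal_01 v : 0 <= mf_marginal v <= 1.
Proof.
suff /andP[h0 h1] : 0 <= k%:R * mf_point v <= 1.
  by rewrite /mf_marginal /flip; case: (fl); apply/andP; split; lra.
have [p0 _] := mf_prob; rewrite mulr_ge0 ?p0 //=.
have := normal_spread (nonadj_01 G rat) (@nonadj_diag n G rat) B_ge0 fl_ge0
  B_small' N_big V_gt0 v q_prob.
rewrite -mf_pointE card_ord => h.
have : (2 * k)%:R * mf_point v <= n%:R * mf_point v.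
  by apply: ler_wpM2r => //; rewrite ler_nat.
rewrite natrM; lra.
Qed.

Lemma mf_marginal_sum : \sum_v mf_marginal v = m%:R.
Proof.
have [_ p1] := mf_prob; rewrite /mf_marginal /flip.
have kE : \sum_v k%:R * mf_point v = k%:R by rewrite -mulr_sumr p1 mulr1.
move: kE; rewrite /k; case: (fl) => // kE.
by rewrite sumrB kE sumr_const card_ord natrB // subKr.
Qed.

Local Notation phi := (@ratr R).

(** The rational data of the iteration are mapped into R, where
    [mean_field_bound] applies. *)
Lemma subset_avg_le :
  ('C(n, m)%:R : R)^-1 * \sum_(T : {set 'I_n} | #|T| == m)
     expR (- (phi B * nonedges G (indic R T)))
  <= expR (62 / 100 - phi B * phi (nonedges G mf_marginal)).
Proof.
pose rho v := boltzmann N (exponent Hr B k%:R fl%:R q) v.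
pose rhoR v : R := phi (rho v).
pose b : R := phi B.
have b0 : 0 <= b by rewrite ler0q.
have bk : b * k%:R <= 2 / 5.
  have : b * m%:R <= 2 / 5.
    have h : B * m%:R <= 2 / 5.
      have -> : B * m%:R = 2 * (g / (m%:R - 1) * m%:R) by rewrite /B; field; rewrite gt_eqF.
      apply: le_trans (ler_wpM2l (ler0n _ 2) g_small) _; lra.
    by have := h; rewrite -(ler_rat R) rmorphM [leRHS]fmorph_div /= !ratr_nat.
  apply: le_trans; apply: ler_wpM2l => //; rewrite ler_nat.
  by move: k_half; rewrite /k; case: (fl) => // h; lia.
pose piR v := rhoR v / \sum_w rhoR w.
have piE v : piR v = phi (mf_point v).
  by rewrite mf_pointE /mf_step /normal fmorph_div /= rmorph_sum.
pose yR v := b * (flip_lin G R fl v + (k%:R - 1) * field (nonadj G R) piR v).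
have yE v : yR v = phi (exponent Hr B k%:R fl%:R mf_point v).
  rewrite exponentE /yR rmorphM /= -/b rmorphB; congr (_ * _).
  rewrite !rmorphM /= rmorphB /= rmorph1 !ratr_nat /Hr ratr_field rmorph_sum.
  rewrite (eq_field _ piE) addrC; congr (_ + _).
  rewrite /flip_lin; case: (fl); rewrite ?mul1r ?mul0r ?oppr0 //.
  by congr (- _); apply: eq_bigr => w _; rewrite /= ratr_nonadj.
pose eps : R := (128 * n%:R)^-1.
have n0 : (0 : R) < n%:R by rewrite ltr0n.
have close v : `|yR v - phi (exponent Hr B k%:R fl%:R q v)| <= (256 * n%:R)^-1.
  have [_ /(_ v)] := conv; rewrite -/q -mf_pointE => h.
  rewrite yE -rmorphB /= -ratr_norm.
  have h2 := le_trans h (pow2_big rat n_gt0).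
  by have := h2; rewrite -(ler_rat R) fmorphV /= rmorphM /= !ratr_nat.
have small v : `|phi (exponent Hr B k%:R fl%:R q v)| <= 9 / 25.
  have h := exponent_bound (nonadj_01 G rat) (@nonadj_diag n G rat) B_ge0 fl_ge0
    B_small' V_gt0 v q_prob.
  by have := h; rewrite -/Hr -(ler_rat R) -ratr_norm fmorph_div /= !ratr_nat.
have rhoE v : rhoR v = (1 - phi (exponent Hr B k%:R fl%:R q v) / N%:R) ^+ N.
  by rewrite /rhoR /rho /boltzmann rmorphXn rmorphB /= rmorph1 fmorph_div /= ratr_nat.
have sq v : 2 * phi (exponent Hr B k%:R fl%:R q v) ^+ 2 / N%:R <= (256 * n%:R)^-1.
  have NE : N%:R = 128 * n%:R :> R by rewrite /N natrM.
  have N0 : 0 < N%:R :> R by rewrite NE mulr_gt0.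
  rewrite ler_pdivrMr // NE.
  have -> : (256 * n%:R)^-1 * (128 * n%:R) = 1 / 2 :> R by field; rewrite gt_eqF.
  have := small v; rewrite ler_norml => /andP[l1 l2].
  set a := phi _ in l1 l2 *.
  have : 0 <= (9 / 25 - a) * (9 / 25 + a) by apply: mulr_ge0; lra.
  lra.
have epsE : eps = (256 * n%:R)^-1 + (256 * n%:R)^-1 by rewrite /eps; field; rewrite gt_eqF.
have lo v : expR (- yR v - eps) <= rhoR v.
  have /andP[h _] := power_expR (small v) N_big; rewrite rhoE.
  apply: le_trans h; rewrite ler_expR epsE.
  have := close v; have := sq v; rewrite ler_norml => ? /andP[? ?]; lra.
have hi v : rhoR v <= expR (- yR v + eps).
  have /andP[_ h] := power_expR (small v) N_big; rewrite rhoE.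
  apply: le_trans h _; rewrite ler_expR epsE.
  have e0 : 0 < (256 * n%:R)^-1 :> R by rewrite invr_gt0 mulr_gt0.
  have := close v; rewrite ler_norml => /andP[? ?]; lra.
have := mean_field_bound (nonadj_sym G R) (nonadj_01 G R) (@nonadj_diag n G R) b0 bk V_gt0 lo hi.
rewrite -/piR card_ord => main.
have margE : phi (nonedges G mf_marginal) =
   (if fl then nonedges G (fun=> 1 : R) else 0) +
   quad (nonadj G R) (flip_lin G R fl) (fun v => k%:R * piR v).
  rewrite ratr_nonedges -nonedges_flip /nonedges; congr (_ * _).
  apply: eq_bil => v; rewrite /mf_marginal /flip piE;
  by case: (fl); rewrite ?rmorphB /= ?rmorph1 rmorphM /= ratr_nat.
pose K : R := if fl then nonedges G (fun=> 1 : R) else 0.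
have sumE : ('C(n, m)%:R : R)^-1 * \sum_(T : {set 'I_n} | #|T| == m)
     expR (- (b * nonedges G (indic R T))) =
   expR (- (b * K)) * (('C(n, k)%:R : R)^-1 * \sum_(T : {set 'I_n} | #|T| == k)
     expR (- (b * quad (nonadj G R) (flip_lin G R fl) (fun v => (v \in T)%:R)))).
  rewrite [RHS]mulrCA [X in _ = _ * X]mulr_sumr.
  have term (T : {set 'I_n}) : expR (- (b * K)) *
      expR (- (b * quad (nonadj G R) (flip_lin G R fl) (fun v => (v \in T)%:R))) =
      expR (- (b * nonedges G (fun v => flip fl (v \in T)%:R))).
    by rewrite nonedges_flip -expRD; congr expR; rewrite -/K; ring.
  under [in RHS]eq_bigr => T _ do rewrite term.
  rewrite /k; move: m_le_n; clear.
  case: fl => // mn.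
  rewrite bin_sub //; congr (_ * _).
  rewrite [LHS](reindex_inj (@setC_inj _)) /=.
  apply: eq_big => T.
    have h : (#|T| + #|~: T| = n)%N by rewrite cardsC card_ord.
    apply/eqP/eqP => e; first by rewrite -(addnK #|~: T| #|T|) h e.
    by rewrite -(addKn #|T| #|~: T|) h e subKn.
  move=> _; congr (expR (- (b * (_ * _)))).
  by apply: eq_bil => v; rewrite /indic /flip inE; case: (v \in T) => /=; ring.
rewrite -/b sumE margE -/K.
apply: le_trans (ler_wpM2l (expR_ge0 _) main) _.
rewrite -expRD ler_expR.
have keps : 2 * k%:R * eps <= 2 / 100.
  rewrite /eps ler_pdivrMr ?mulr_gt0 //.
  have : (2 * k)%:R <= n%:R :> R by rewrite ler_nat.
  rewrite natrM; lra.
lra.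
Qed.

End Correctness.

(** * Total correctness and cost of programs *)

Local Open Scope nat_scope.

(** A bound on the running time of programs all of whose loops make at most L
    rounds.  It is read off the syntax, so the rules below need not mention
    costs. *)
Fixpoint step_bound (L : nat) (c : prog) : nat :=
  match c with
  | PSkip => 1
  | PISet _ i e => (icost i + icost e).+1
  | PQSet _ i e => (icost i + qcost e).+1
  | PSeq c1 c2 => step_bound L c1 + step_bound L c2
  | PIf b c1 c2 => tcost b + (step_bound L c1 + step_bound L c2)
  | PWhile b c => L * (tcost b + step_bound L c) + tcost b
  end.

(** An exponent for which [step_bound] is at most the corresponding power of
    L; constants k are absorbed as k <= L^k. *)
Fixpoint degree (c : prog) : nat :=
  match c with
  | PSkip => 1
  | PISet _ i e => (icost i + icost e).+1
  | PQSet _ i e => (icost i + qcost e).+1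
  | PSeq c1 c2 => (degree c1 + degree c2).+1
  | PIf b c1 c2 => (tcost b + degree c1 + degree c2).+2
  | PWhile b c => (tcost b + degree c).+3
  end.

Lemma step_bound_le L c : 1 < L -> step_bound L c <= L ^ degree c.
Proof.
move=> L1.
have L0 : 0 < L by apply: ltnW.
have small k : k <= L ^ k by apply: ltnW; apply: ltn_expl.
have two a b : L ^ a + L ^ b <= L ^ (a + b).+1.
  rewrite expnS; apply: leq_trans (_ : 2 * L ^ (a + b) <= _); last by rewrite leq_mul2r L1 orbT.
  by rewrite mul2n -addnn leq_add // leq_exp2l // ?leq_addr ?leq_addl.
elim: c => [|a i e|a i e|c1 IH1 c2 IH2|b c1 IH1 c2 IH2|b c IH];
  [exact: small|exact: small|exact: small| | |]; rewrite [step_bound _ _]/= [degree _]/=.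
- exact: leq_trans (leq_add IH1 IH2) (two _ _).
- apply: leq_trans (leq_add (small _) (leq_trans (leq_add IH1 IH2) (two _ _))) _.
  by apply: leq_trans (two _ _) _; rewrite leq_exp2l //; lia.
- apply: leq_trans (_ : L ^ (tcost b + degree c).+2 + L ^ tcost b <= _).
    rewrite leq_add // expnS leq_mul2l; apply/orP; right.
    exact: leq_trans (leq_add (small _) IH) (two _ _).
  apply: leq_trans (_ : L ^ (tcost b + degree c).+2 * 2 <= _).
    by rewrite muln2 -addnn leq_add2l leq_exp2l //; lia.
  by rewrite [leqRHS]expnSr leq_mul2l L1 orbT.
Qed.

(** Weakest precondition for total correctness, with the cost bound included. *)
Definition wp L c s (Q : store -> Prop) :=
  exists t s', [/\ run c s t s', t <= step_bound L c & Q s'].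

Section Wp.
Variable L : nat.

Definition seti s a i v := Store (upd s.(imem) a i v) s.(qmem).
Definition setq s a i v := Store s.(imem) (upd s.(qmem) a i v).

Lemma wp_weaken c s (P Q : store -> Prop) :
  wp L c s P -> (forall s', P s' -> Q s') -> wp L c s Q.
Proof. by move=> [t [s' [r k p]]] PQ; exists t, s'; split; last exact: PQ. Qed.

Lemma wp_skip s (Q : store -> Prop) : Q s -> wp L PSkip s Q.
Proof. by exists 1, s; split => //; exact: run_skip. Qed.

Lemma wp_iset a i e s (Q : store -> Prop) :
  Q (seti s a (ieval s i) (ieval s e)) -> wp L (PISet a i e) s Q.
Proof. by move=> q; eexists _, _; split; [exact: run_iset | exact: leqnn | exact: q]. Qed.

Lemma wp_qset a i e s (Q : store -> Prop) :
  Q (setq s a (ieval s i) (qeval s e)) -> wp L (PQSet a i e) s Q.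
Proof. by move=> q; eexists _, _; split; [exact: run_qset | exact: leqnn | exact: q]. Qed.

Lemma wp_seq c1 c2 s (Q : store -> Prop) :
  wp L c1 s (fun s' => wp L c2 s' Q) -> wp L (PSeq c1 c2) s Q.
Proof.
move=> [t1 [s1 [r1 k1 [t2 [s2 [r2 k2 q]]]]]]; exists (t1 + t2), s2; split => //.
  exact: run_seq r1 r2.
exact: leq_add.
Qed.

Lemma wp_if b c1 c2 s (Q : store -> Prop) :
  wp L (if teval s b then c1 else c2) s Q -> wp L (PIf b c1 c2) s Q.
Proof.
move=> [t [s' [r k q]]]; exists (tcost b + t), s'; split => //=; first exact: run_if.
rewrite leq_add2l; apply: leq_trans k _.
by case: ifP => _; rewrite ?leq_addr ?leq_addl.
Qed.

Lemma wp_while b c (Inv : nat -> store -> Prop) lo hi s (Q : store -> Prop) :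
    hi - lo <= L -> lo <= hi -> Inv lo s ->
    (forall i s, lo <= i <= hi -> Inv i s -> teval s b = (i < hi)) ->
    (forall i s, lo <= i < hi -> Inv i s -> wp L c s (Inv i.+1)) ->
    (forall s, Inv hi s -> Q s) ->
  wp L (PWhile b c) s Q.
Proof.
move=> hL lh inv0 tst body post.
suff [t [s' [r k q]]] : exists t s', [/\ run (PWhile b c) s t s',
    t <= (hi - lo) * (tcost b + step_bound L c) + tcost b & Q s'].
  exists t, s'; split => //=; apply: leq_trans k _.
  by rewrite leq_add2r leq_mul2r hL orbT.
have [d hd] : exists d, d = hi - lo by exists (hi - lo).
rewrite -hd; elim: d lo s lh inv0 hd {hL} tst body => [|d IH] lo s lh inv0 hd tst body.
  have e : lo = hi by lia.
  exists (tcost b), s; split; last by apply: post; rewrite -e.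
    by apply: run_while_stop; rewrite (tst lo) ?e ?ltnn ?leqnn // -?e.
  by rewrite mul0n.
have lt : lo < hi by lia.
have [t1 [s1 [r1 k1 q1]]] := body lo s (introT andP (conj (leqnn _) lt)) inv0.
have [|||t2 [s2 [r2 k2 q2]]] := IH lo.+1 s1 lt q1; first by lia.
- by move=> i s' /andP[h1 h2]; apply: tst; rewrite h2 ltnW.
- by move=> i s' /andP[h1 h2]; apply: body; rewrite h2 ltnW.
exists (tcost b + t1 + t2), s2; split => //.
  by apply: run_while_step r1 r2; rewrite (tst lo) ?leqnn.
by rewrite mulSn -[X in _ <= X]addnA leq_add // leq_add.
Qed.

Definition IVar x := IGet 0 (ICst x).
Definition QVar x := QGet 0 (ICst x).

Definition For x lo e body :=
  PSeq (PISet 0 (ICst x) (ICst lo))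
    (PWhile (ILt (IVar x) e)
       (PSeq body (PISet 0 (ICst x) (IAdd (IVar x) (ICst 1))))).

Lemma wp_for x lo e body (Inv : nat -> store -> Prop) hi s (Q : store -> Prop) :
    hi <= L -> lo <= hi ->
    Inv lo (seti s 0 x lo) ->
    (forall i s, Inv i s -> imem s 0 x = i /\ ieval s e = hi) ->
    (forall i s, lo <= i < hi -> Inv i s ->
       wp L body s (fun s' => imem s' 0 x = i /\ Inv i.+1 (seti s' 0 x i.+1))) ->
    (forall s, Inv hi s -> Q s) ->
  wp L (For x lo e body) s Q.
Proof.
move=> hL lh inv0 hx step post; apply/wp_seq/wp_iset.
apply: (@wp_while _ _ Inv lo hi) => //.
- by apply: leq_trans hL; exact: leq_subr.
- by move=> i s' _ /hx[/= -> ->].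
move=> i s' hi' inv; apply: wp_seq.
apply: wp_weaken (step _ _ hi' inv) _ => s2 [xi inv2].
by apply: wp_iset; rewrite /= xi addn1.
Qed.

Definition Acc x e d q0 f :=
  PSeq (PQSet 0 (ICst d) q0) (For x 0 e (PQSet 0 (ICst d) f)).

Lemma upd_upd T (f : nat -> nat -> T) a i v w : upd (upd f a i v) a i w = upd f a i w.
Proof.
by do 2!apply: functional_extensionality => ?; rewrite /upd; case: (_ && _).
Qed.

Lemma upd_id T (f : nat -> nat -> T) a i v : upd f a i v a i = v.
Proof. by rewrite /upd !eqxx. Qed.

(** An accumulation loop writes only its counter and its accumulator, so its
    final store is known exactly. *)
Lemma wp_acc x e d q0 f (a : nat -> rat) hi s (Q : store -> Prop) :
  let st i := Store (upd s.(imem) 0 x i) (upd s.(qmem) 0 d (a i)) in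
    hi <= L -> qeval s q0 = a 0 ->
    (forall i, i <= hi -> ieval (st i) e = hi) ->
    (forall i, i < hi -> qeval (st i) f = a i.+1) ->
    Q (st hi) ->
  wp L (Acc x e d q0 f) s Q.
Proof.
move=> st hL a0 he hf q; apply/wp_seq/wp_qset; rewrite a0.
apply: (@wp_for _ _ _ _ (fun i s' => i <= hi /\ s' = st i) hi) => //.
- by move=> i s' [hi' ->]; rewrite he // /= upd_id.
- move=> i s' /andP[_ lt] [_ ->]; apply: wp_qset; rewrite /= upd_id; split=> //.
  split=> //; rewrite [qeval _ _]hf // /st /seti /setq /=.
  by rewrite !upd_upd.
- by move=> s' [_ ->].
Qed.

End Wp.

Local Open Scope ring_scope.

(** * The program *)

(** Cells of index array 0: 0 and 1 are n and m, 2 is the size k of the sampled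
    sets, 3 tells whether they are complements, 4 is N, 5 to 8 are loop
    counters, 9 and 10 are the two coordinates being rounded.  Rational
    array 0: cell 0 is b = 2 g / (m - 1), 1 to 4 are accumulators, 5 and 6 hold
    the mass of the two coordinates and the part assigned to the first.
    Rational arrays 1, 2 and 3 are the law pi, its weights before
    normalisation, and the fractional point.

    Truncated subtraction gives the 0/1 indicator of non-adjacency of distinct
    vertices without a test. *)
Definition nonadj_exp v w : iexp :=
  ISub (ISub (ICst 1) (IGet 1 (IAdd (IMul v (IVar 0)) w)))
       (ISub (ICst 1) (IAdd (ISub v w) (ISub w v))).

Definition exponent_loop :=
  Acc 7 (IVar 0) 1 (QCst 0)
    (QAdd (QVar 1)
      (QMul (QInj (nonadj_exp (IVar 6) (IVar 7)))
        (QSub (QMul (QSub (QInj (IVar 2)) (QCst 1)) (QGet 1 (IVar 7)))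
              (QInj (IVar 3))))).

Definition power_loop :=
  Acc 8 (IVar 4) 2 (QCst 1)
    (QMul (QVar 2) (QSub (QCst 1) (QDiv (QMul (QVar 0) (QVar 1)) (QInj (IVar 4))))).

Definition boltzmann_body :=
  PSeq exponent_loop (PSeq power_loop (PQSet 2 (IVar 6) (QVar 2))).

Definition total_loop := Acc 6 (IVar 0) 3 (QCst 0) (QAdd (QVar 3) (QGet 2 (IVar 6))).

Definition mf_body :=
  PSeq (For 6 0 (IVar 0) boltzmann_body)
    (PSeq total_loop
       (For 6 0 (IVar 0) (PQSet 1 (IVar 6) (QDiv (QGet 2 (IVar 6)) (QVar 3))))).

Definition slope_loop :=
  Acc 7 (IVar 0) 4 (QCst 0)
    (QAdd (QVar 4)
      (QMul (QSub (QInj (nonadj_exp (IVar 9) (IVar 7)))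
                  (QInj (nonadj_exp (IVar 10) (IVar 7))))
            (QGet 3 (IVar 7)))).

Definition transfer :=
  PSeq (PQSet 0 (ICst 5) (QAdd (QGet 3 (IVar 9)) (QGet 3 (IVar 10))))
  (PSeq (PIf (QLt (QCst 0) (QVar 4))
          (PIf (QLt (QCst 1) (QVar 5))
             (PQSet 0 (ICst 6) (QSub (QVar 5) (QCst 1)))
             (PQSet 0 (ICst 6) (QCst 0)))
          (PIf (QLt (QCst 1) (QVar 5))
             (PQSet 0 (ICst 6) (QCst 1))
             (PQSet 0 (ICst 6) (QVar 5))))
  (PSeq (PQSet 3 (IVar 9) (QVar 6))
        (PQSet 3 (IVar 10) (QSub (QVar 5) (QVar 6))))).

Definition rounding_body :=
  PSeq slope_loop
  (PSeq transfer
    (PIf (TAnd (QLt (QCst 0) (QGet 3 (IVar 9))) (QLt (QGet 3 (IVar 9)) (QCst 1)))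
       PSkip
       (PISet 0 (ICst 9) (IVar 10)))).

Definition setup (g : rat) :=
  PSeq (PIf (ILt (IVar 0) (IAdd (IVar 1) (IVar 1)))
          (PSeq (PISet 0 (ICst 2) (ISub (IVar 0) (IVar 1))) (PISet 0 (ICst 3) (ICst 1)))
          (PSeq (PISet 0 (ICst 2) (IVar 1)) (PISet 0 (ICst 3) (ICst 0))))
  (PSeq (PISet 0 (ICst 4) (IMul (ICst 128) (IVar 0)))
        (PQSet 0 (ICst 0) (QDiv (QCst (2 * g)) (QSub (QInj (IVar 1)) (QCst 1))))).

Definition uniform_loop :=
  For 6 0 (IVar 0) (PQSet 1 (IVar 6) (QDiv (QCst 1) (QInj (IVar 0)))).

Definition marginal_loop :=
  For 6 0 (IVar 0)
    (PIf (ILt (ICst 0) (IVar 3))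
       (PQSet 3 (IVar 6) (QSub (QCst 1) (QMul (QInj (IVar 2)) (QGet 1 (IVar 6)))))
       (PQSet 3 (IVar 6) (QMul (QInj (IVar 2)) (QGet 1 (IVar 6))))).

Definition rounding_loop := PSeq (PISet 0 (ICst 9) (ICst 0)) (For 10 1 (IVar 0) rounding_body).

Definition output_loop :=
  For 6 0 (IVar 0)
    (PIf (QLt (QCst 2^-1) (QGet 3 (IVar 6)))
       (PISet 2 (IVar 6) (ICst 1)) (PISet 2 (IVar 6) (ICst 0))).

Definition dense_subset_prog (g : rat) :=
  PSeq (setup g) (PSeq uniform_loop (PSeq (For 5 0 (IVar 4) mf_body)
    (PSeq marginal_loop (PSeq rounding_loop output_loop)))).

Section Phases.
Variables (n : nat) (G : sgraph n) (k : nat) (fl : bool) (N : nat) (B : rat) (L : nat).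
Hypothesis n_le_L : (n <= L)%N.
Hypothesis N_le_L : (N <= L)%N.

(** The part of the store that no phase after the initialisation modifies. *)
Definition Base (s : store) :=
  [/\ imem s 0 0 = n, imem s 0 2 = k, imem s 0 3 = fl, imem s 0 4 = N & qmem s 0 0 = B]
  /\ forall v w : 'I_n, imem s 1 (v * n + w)%N = G v w.

Local Notation H := (nonadj G rat).
Local Notation xpt := (exponent H B k%:R fl%:R).

Definition row a (s : store) (v : 'I_n) : rat := qmem s a v.

Lemma eval_nonadj s ev ew (v w : 'I_n) : Base s ->
  ieval s ev = v -> ieval s ew = w -> (ieval s (nonadj_exp ev ew))%:R = H v w.
Proof.
move=> [[h0 _ _ _ _] hG] hv hw; rewrite /nonadj_exp /= hv hw h0 hG /nonadj.
case: eqVneq => [->|vw]; first by rewrite adj_irr subnn.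
have -> : (1 - (v - w + (w - v)) = 0)%N.
  have : (v : nat) != w by [].
  lia.
by case: (G v w).
Qed.

Lemma exponent_spec s (v : 'I_n) (Q : store -> Prop) : Base s -> imem s 0 6 = v ->
  (forall A, B * A = xpt (row 1 s) v ->
     Q (Store (upd (imem s) 0 7 n) (upd (qmem s) 0 1 A))) ->
  wp L exponent_loop s Q.
Proof.
move=> hB hv hQ; have [[h0 h2 h3 h4 hb] hG] := hB.
pose val (w : nat) : rat := (ieval (seti s 0 7 w) (nonadj_exp (IVar 6) (IVar 7)))%:R *
   ((k%:R - 1) * qmem s 1 w - fl%:R).
apply: (@wp_acc _ _ _ _ _ _ (fun i => \sum_(w < i) val w) n) => //=.
- by rewrite big_ord0.
- by move=> i lt; rewrite big_ord_recr /= /val /= /upd /= h2 h3.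
apply: hQ; rewrite /exponent; congr (_ * _); apply: eq_bigr => w _.
rewrite /val (@eval_nonadj (seti s 0 7 w) _ _ v w) //; rewrite /= /upd //=.
Qed.

Lemma power_spec s x (Q : store -> Prop) : Base s -> B * qmem s 0 1 = x ->
  Q (Store (upd (imem s) 0 8 N) (upd (qmem s) 0 2 ((1 - x / N%:R) ^+ N))) ->
  wp L power_loop s Q.
Proof.
move=> hB hx hQ; have [[h0 h2 h3 h4 hb] hG] := hB.
apply: (@wp_acc _ _ _ _ _ _ (fun i => (1 - x / N%:R) ^+ i) N) => //=.
by move=> i lt; rewrite /upd /= h4 hb hx exprSr.
Qed.

Lemma boltzmann_spec s (Q : store -> Prop) : Base s ->
  (forall s', Base s' -> imem s' 0 5 = imem s 0 5 -> row 1 s' =1 row 1 s ->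
     row 2 s' =1 boltzmann N (xpt (row 1 s)) -> Q s') ->
  wp L (For 6 0 (IVar 0) boltzmann_body) s Q.
Proof.
move=> hB hQ.
apply: (@wp_for _ _ _ _ _ (fun i s' => [/\ Base s' /\ imem s' 0 6 = i,
    imem s' 0 5 = imem s 0 5, row 1 s' =1 row 1 s &
    forall v : 'I_n, (v < i)%N -> row 2 s' v = boltzmann N (xpt (row 1 s)) v]) n) => //.
- by move=> i s' [[[[h0 _ _ _ _] _] h6] _ _ _].
- move=> i s' /andP[_ lt] [[hB' h6] h5 r1 r2].
  apply/wp_seq/(@exponent_spec _ (Ordinal lt)) => // A AE.
  apply/wp_seq/(@power_spec _ (xpt (row 1 s) (Ordinal lt))).
  + exact: hB'.
  + by rewrite /= upd_id AE; exact: eq_exponent.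
  apply: wp_qset; split; first by rewrite /= /upd /=.
  split.
  + by split; first by move: hB'; rewrite /Base /= /upd /=.
  + by rewrite /= /upd /=.
  + by move=> v; rewrite /row /= /upd /=; apply: r1.
  + move=> v vi; rewrite /row /= /upd /= h6.
    case: eqP => [vE|/eqP vi'].
      by rewrite /boltzmann; congr (_ ^+ _); congr (1 - xpt _ _ / _); apply: val_inj.
    by apply: r2; lia.
- move=> s' [[hB' h6] h5 r1 r2]; apply: hQ => // v; exact: r2.
Qed.

Lemma mf_body_spec s (Q : store -> Prop) : Base s ->
  (forall s', Base s' -> imem s' 0 5 = imem s 0 5 ->
     row 1 s' =1 mf_step H B k%:R fl%:R N (row 1 s) -> Q s') ->
  wp L mf_body s Q.
Proof.
move=> hB hQ; apply/wp_seq/boltzmann_spec => // s1 hB1 h51 r11 r21.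
have [[h0 h2 h3 h4 hb] hG] := hB1.
apply/wp_seq/(@wp_acc _ _ _ _ _ _ (fun i => \sum_(w < i) qmem s1 2 w) n) => //=.
- by rewrite big_ord0.
- by move=> i lt; rewrite big_ord_recr /= /upd /=.
set tot := \sum_(w < n) _.
apply: (@wp_for _ _ _ _ _ (fun i s' => [/\ Base s' /\ imem s' 0 6 = i,
    imem s' 0 5 = imem s1 0 5 /\ qmem s' 0 3 = tot, row 2 s' =1 row 2 s1 &
    forall v : 'I_n, (v < i)%N -> row 1 s' v = row 2 s1 v / tot]) n) => //.
- by move=> i s' [[[[h0' _ _ _ _] _] h6] _ _ _].
- move=> i s' /andP[_ lt] [[hB' h6] [h5 htot] r2 r1].
  apply: wp_qset; split; first by rewrite /= /upd /=.
  split.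
  + by split; first by move: hB'; rewrite /Base /= /upd /=.
  + by rewrite /= /upd /=.
  + by move=> v; rewrite /row /= /upd /=; apply: r2.
  + move=> v vi; rewrite /row /= /upd /= h6.
    case: eqP => [<-|/eqP vi']; first by rewrite htot; congr (_ / _); exact: r2.
    by apply: r1; lia.
- move=> s' [[hB' h6] [h5 htot] r2 r1]; apply: hQ => //; first by rewrite h5.
  move=> v; rewrite r1 // /mf_step /normal r21 /tot; congr (_ / _).
  by apply: eq_bigr => w _; exact: r21.
Qed.

Lemma eq_mf_step p p' : p =1 p' ->
  mf_step H B k%:R fl%:R N p =1 mf_step H B k%:R fl%:R N p'.
Proof.
move=> e v; rewrite /mf_step /normal /boltzmann (eq_exponent _ _ _ _ e); congr (_ / _).
by apply: eq_bigr => w _; rewrite (eq_exponent _ _ _ _ e).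
Qed.

Lemma mf_loop_spec s (Q : store -> Prop) p : Base s -> row 1 s =1 p ->
  (forall s', Base s' -> row 1 s' =1 iter N (mf_step H B k%:R fl%:R N) p -> Q s') ->
  wp L (For 5 0 (IVar 4) mf_body) s Q.
Proof.
move=> hB hp hQ.
apply: (@wp_for _ _ _ _ _ (fun i s' => [/\ Base s', imem s' 0 5 = i &
   row 1 s' =1 iter i (mf_step H B k%:R fl%:R N) p]) N) => //.
- by move=> i s' [[[_ _ _ h4 _] _] h5 _].
- move=> i s' _ [hB' h5 r1]; apply: mf_body_spec => // s2 hB2 h52 r2.
  split; first by rewrite h52.
  split.
  + by move: hB2; rewrite /Base /= /upd /=.
  + by rewrite /= upd_id.
  + move=> v; rewrite (_ : row 1 _ v = row 1 s2 v) // r2; exact: eq_mf_step.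
- by move=> s' [hB' _ r]; exact: hQ.
Qed.

Lemma uniform_spec s (Q : store -> Prop) : Base s ->
  (forall s', Base s' -> row 1 s' =1 (fun=> n%:R^-1) -> Q s') ->
  wp L uniform_loop s Q.
Proof.
move=> hB hQ.
apply: (@wp_for _ _ _ _ _ (fun i s' => [/\ Base s', imem s' 0 6 = i &
    forall v : 'I_n, (v < i)%N -> row 1 s' v = n%:R^-1]) n) => //.
- by move=> i s' [[[h0' _ _ _ _] _] h6 _].
- move=> i s' /andP[_ lt] [hB' h6 r1].
  have [[h0 _ _ _ _] _] := hB'.
  apply: wp_qset; split; first by rewrite /= /upd /=.
  split; first by move: hB'; rewrite /Base /= /upd /=.
    by rewrite /= /upd /=.
  move=> v vi; rewrite /row /= /upd /= h6 h0.
  case: eqP => [_|/eqP vi']; first by rewrite div1r.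
  by apply: r1; lia.
- by move=> s' [hB' h6 r1]; apply: hQ => // v; exact: r1.
Qed.

Lemma marginal_spec s (Q : store -> Prop) : Base s ->
  (forall s', Base s' -> row 3 s' =1 (fun v => flip fl (k%:R * row 1 s v)) -> Q s') ->
  wp L marginal_loop s Q.
Proof.
move=> hB hQ.
apply: (@wp_for _ _ _ _ _ (fun i s' => [/\ Base s', imem s' 0 6 = i,
    row 1 s' =1 row 1 s &
    forall v : 'I_n, (v < i)%N -> row 3 s' v = flip fl (k%:R * row 1 s v)]) n) => //.
- by move=> i s' [[[h0' _ _ _ _] _] h6 _].
- move=> i s' /andP[_ lt] [hB' h6 r1 r3].
  have [[h0 h2 h3 _ _] _] := hB'.
  apply: (@wp_weaken _ _ _ (fun s2 => s2 = setq s' 3 i (flip fl (k%:R * row 1 s (Ordinal lt))))).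
    by apply: wp_if; rewrite /= h3 /flip; case: (fl) => /=; apply: wp_qset;
      rewrite /= h6 h2 -(r1 (Ordinal lt)).
  move=> _ ->; split; first by rewrite /= /upd /=.
  split; first by move: hB'; rewrite /Base /= /upd /=.
  + by rewrite /= /upd /=.
  + by move=> v; apply: r1.
  + move=> v vi; rewrite /row /= /upd /=.
    case: eqP => [vE|/eqP vi']; last by apply: r3; lia.
    by rewrite (_ : v = Ordinal lt) //; apply: val_inj.
- by move=> s' [hB' h6 r1 r3]; apply: hQ => // v; exact: r3.
Qed.

Lemma slope_spec s (i j : 'I_n) (Q : store -> Prop) : Base s ->
  imem s 0 9 = i -> imem s 0 10 = j ->
  Q (Store (upd (imem s) 0 7 n)
      (upd (qmem s) 0 4 (field H (row 3 s) i - field H (row 3 s) j))) ->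
  wp L slope_loop s Q.
Proof.
move=> hB hi hj hQ; have [[h0 h2 h3 h4 hb] hG] := hB.
pose val (w : nat) : rat :=
  ((ieval (seti s 0 7 w) (nonadj_exp (IVar 9) (IVar 7)))%:R -
   (ieval (seti s 0 7 w) (nonadj_exp (IVar 10) (IVar 7)))%:R) * qmem s 3 w.
apply: (@wp_acc _ _ _ _ _ _ (fun i => \sum_(w < i) val w) n) => //=.
- by rewrite big_ord0.
- by move=> a lt; rewrite big_ord_recr /= /val /= /upd /=.
suff -> : \sum_(w < n) val w = field H (row 3 s) i - field H (row 3 s) j by [].
have hBw (w : 'I_n) : Base (seti s 0 7 w) by move: hB; rewrite /Base /= /upd /=.
rewrite /field -sumrB; apply: eq_bigr => w _; rewrite -mulrBl /val.
have -> : (ieval (seti s 0 7 w) (nonadj_exp (IVar 9) (IVar 7)))%:R = H i w.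
  by apply: eval_nonadj => //; rewrite /= /upd /=.
have -> // : (ieval (seti s 0 7 w) (nonadj_exp (IVar 10) (IVar 7)))%:R = H j w.
by apply: eval_nonadj => //; rewrite /= /upd /=.
Qed.

Lemma transfer_spec s (i j : 'I_n) (Q : store -> Prop) : Base s ->
  imem s 0 9 = i -> imem s 0 10 = j -> i != j ->
  qmem s 0 4 = field H (row 3 s) i - field H (row 3 s) j ->
  (forall s', Base s' -> imem s' = imem s ->
    row 3 s' =1 (let a := shift_to H (row 3 s) i j in
        setp (setp (row 3 s) i a) j (row 3 s i + row 3 s j - a)) -> Q s') ->
  wp L transfer s Q.
Proof.
move=> hB hi hj ij hD hQ.
apply/wp_seq/wp_qset; rewrite /= hi hj.
set s1 := setq _ _ _ _.
apply/wp_seq; apply: (@wp_weaken _ _ _ (fun s2 => s2 = setq s1 0 6 (shift_to H (row 3 s) i j))).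
  have D1 : qmem s1 0 4 = field H (row 3 s) i - field H (row 3 s) j by rewrite /s1 /= /upd /=.
  have S1 : qmem s1 0 5 = row 3 s i + row 3 s j by rewrite /s1 /= /upd /=.
  move: s1 D1 S1 => s1 D1 S1.
  apply: wp_if; rewrite /= D1 /shift_to.
  case: lerP => _; apply: wp_if; rewrite /= S1; case: lerP => _;
    by apply: wp_qset; rewrite /= ?S1.
move=> _ ->; apply/wp_seq/wp_qset/wp_qset; apply: hQ.
- by move: hB; rewrite /Base /= /upd /=.
- by [].
- move=> v; rewrite /row /= /upd /= hi hj /setp.
  case: (eqVneq v j) => [->|vj]; first by rewrite eqxx.
  have -> : (v == j :> nat) = false by apply/negbTE.
  by case: (eqVneq v i) => [->|vi]; rewrite ?eqxx // (_ : (v == i :> nat) = false) //; apply/negbTE.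
Qed.

(** Before round j, every coordinate below j is 0 or 1 except possibly the one
    whose index is in cell 9. *)
Lemma rounding_spec s m (Q : store -> Prop) : Base s -> (0 < n)%N ->
  (forall v, 0 <= row 3 s v <= 1) -> \sum_v row 3 s v = m%:R ->
  (forall s', Base s' -> (forall v, (row 3 s' v == 0) || (row 3 s' v == 1)) ->
     \sum_v row 3 s' v = m%:R ->
     bil H (row 3 s') (row 3 s') <= bil H (row 3 s) (row 3 s) -> Q s') ->
  wp L rounding_loop s Q.
Proof.
move=> hB n0 p01 psum hQ; apply/wp_seq/wp_iset.
pose Inv j s' := [/\ Base s', imem s' 0 10 = j,
  exists2 i : 'I_n, imem s' 0 9 = i & (i < j)%N /\
     forall v : 'I_n, (v < j)%N -> v != i -> (row 3 s' v == 0) || (row 3 s' v == 1),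
  (forall v, 0 <= row 3 s' v <= 1) /\ \sum_v row 3 s' v = m%:R &
  bil H (row 3 s') (row 3 s') <= bil H (row 3 s) (row 3 s)].
apply: (@wp_for _ _ _ _ _ Inv n) => //.
- split.
  + by move: hB; rewrite /Base /= /upd /=.
  + by rewrite /= /upd /=.
  + exists (Ordinal n0); first by rewrite /= /upd /=.
    by split=> // v; rewrite ltnS leqn0 => /eqP v0 /eqP[]; apply: val_inj.
  + by [].
  + by [].
- by move=> j s' [[[h0 _ _ _ _] _] h10 _ _ _].
- move=> j s1 /andP[j1 jn] [hB1 h10 [i h9 [ij hint]] [q01 qsum] qle].
  pose jj := Ordinal jn.
  have inej : i != jj by rewrite -(inj_eq val_inj) /= neq_ltn ij.
  apply/wp_seq/(@slope_spec _ i jj) => //.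
  set s2 := Store _ _.
  have hB2 : Base s2 by move: hB1; rewrite /Base /= /upd /=.
  apply/wp_seq/(@transfer_spec s2 i jj) => //.
  move=> s3 hB3 e3 r3.
  have h93 : imem s3 0 9 = i by rewrite e3.
  have h103 : imem s3 0 10 = jj by rewrite e3.
  have r12 : row 3 s2 = row 3 s1 by [].
  rewrite r12 in r3.
  set a := shift_to _ _ _ _ in r3.
  have /= [sl a01 b01 int] := @shift_to_spec _ _ H (row 3 s1) i jj (q01 i) (q01 jj).
  rewrite -/a in sl a01 b01 int.
  set p' := (let a := _ in _) in r3.
  have p'i : p' i = a by rewrite /p' /setp (negPf inej) eqxx.
  have p'j : p' jj = row 3 s1 i + row 3 s1 jj - a by rewrite /p' /setp eqxx.
  have p'v v : v != i -> v != jj -> p' v = row 3 s1 v.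
    by move=> vi vj; rewrite /p' /setp (negPf vi) (negPf vj).
  have sum' : \sum_v p' v = m%:R by rewrite -qsum; exact: transfer_sum.
  have le' : bil H p' p' <= bil H (row 3 s) (row 3 s).
    apply: le_trans qle; apply: transfer_bil => //.
    + exact: nonadj_sym.
    + exact: nonadj_01.
    + exact: nonadj_diag.
  have p'01 v : 0 <= p' v <= 1.
    case: (eqVneq v i) => [->|vi]; first by rewrite p'i.
    by case: (eqVneq v jj) => [->|vj]; rewrite ?p'j // p'v.
  have keep s4 : row 3 s4 =1 row 3 s3 ->
     (forall v, 0 <= row 3 s4 v <= 1) /\ \sum_v row 3 s4 v = m%:R.
    move=> e; split=> [v|]; first by rewrite e r3.
    by rewrite -sum'; apply: eq_bigr => v _; rewrite e r3.
  have keep2 s4 : row 3 s4 =1 row 3 s3 ->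
     bil H (row 3 s4) (row 3 s4) <= bil H (row 3 s) (row 3 s).
    move=> e; have e' : row 3 s4 =1 p' by move=> v; rewrite e r3.
    by rewrite (eq_bil _ e' e').
  have hi3 : qmem s3 3 i = p' i by exact: (r3 i).
  apply: wp_if; rewrite [teval _ _]/= h93 hi3 p'i.
  case: ifPn => frac.
    apply: wp_skip; split; first by rewrite h103.
    split.
    + by move: hB3; rewrite /Base /= /upd /=.
    + by rewrite /= upd_id.
    + exists i; first by rewrite /= /upd /=.
      split=> [|v vj vi]; first exact: ltnW.
      rewrite (_ : row 3 _ v = row 3 s3 v) // r3.
      case: (eqVneq v jj) => [->|vj'].
        rewrite p'j; case/orP: int => [/orP[/orP[]|->]|->]; rewrite ?orbT //.
          by move=> /eqP a0; move: frac; rewrite a0 ltxx.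
        by move=> /eqP a1; move: frac; rewrite a1 ltxx andbF.
      rewrite p'v //; apply: hint => //.
      by move: vj; rewrite ltnS leq_eqVlt => /orP[/eqP e|//]; case/eqP: vj'; apply: val_inj.
    + exact: keep.
    + exact: keep2.
  apply: wp_iset; rewrite /= h103 /=; split; first by rewrite /= /upd /=.
  split.
  + by move: hB3; rewrite /Base /= /upd /=.
  + by rewrite /= upd_id.
  + exists jj; first by rewrite /= /upd /=.
    split=> [|v vj vi]; first exact: leqnn.
    rewrite (_ : row 3 _ v = row 3 s3 v) // r3.
    case: (eqVneq v i) => [->|vi'].
      rewrite p'i; case/andP: a01 => a0 a1; move: frac.
      by rewrite negb_and -!leNgt => /orP[] h; apply/orP; [left|right]; rewrite eq_le h ?a0 ?a1.
    rewrite p'v //; apply: hint => //.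
    by move: vj; rewrite ltnS leq_eqVlt => /orP[/eqP e|//]; case/eqP: vi; apply: val_inj.
  + exact: keep.
  + exact: keep2.
- move=> s' [hB' h10 [i h9 [_ hint]] [q01 qsum] qle]; apply: hQ => // v.
  case: (eqVneq v i) => [->|vi]; last exact: hint.
  (* the last coordinate is integral because the total is *)
  have : row 3 s' i \is a Num.int.
    have -> : row 3 s' i = m%:R - \sum_(v | v != i) row 3 s' v.
      by rewrite -qsum [in RHS](bigD1 i) //= addrK.
    rewrite rpredB ?rpred_nat // rpred_sum // => w wi.
    by case/orP: (hint w (ltn_ord w) wi) => /eqP->.
  case/andP: (q01 i) => i0 i1; case/intrP => z zE; rewrite zE in i0 i1 *.
  move: i0 i1; rewrite -[1]/(1%:~R) -[0]/(0%:~R) !ler_int !eqr_int.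
  by case: z {zE} => [[|[|?]]|?].
Qed.

Lemma output_spec s (Q : store -> Prop) : Base s ->
  (forall s', (forall v : 'I_n, (imem s' 2 v != 0%N) = (2^-1 < row 3 s v)) -> Q s') ->
  wp L output_loop s Q.
Proof.
move=> hB hQ.
apply: (@wp_for _ _ _ _ _ (fun i s' => [/\ imem s' 0 0 = n, imem s' 0 6 = i,
    row 3 s' =1 row 3 s &
    forall v : 'I_n, (v < i)%N -> (imem s' 2 v != 0%N) = (2^-1 < row 3 s v)]) n) => //.
- by split => //; rewrite /= /upd /=; case: hB => -[].
- by move=> i s' [h0 h6 _ _].
- move=> i s' /andP[_ lt] [h0 h6 r3 r2].
  pose c := nat_of_bool (2^-1 < row 3 s (Ordinal lt)).
  apply: (@wp_weaken _ _ _ (fun s2 => s2 = seti s' 2 i c)).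
    apply: wp_if; rewrite /= h6 (r3 (Ordinal lt) : qmem s' 3 i = _) /c.
    by case: ifP => _; apply: wp_iset; rewrite /= h6.
  move=> _ ->; split; first by rewrite /= /upd /=.
  split=> //=; try by rewrite /upd /=.
  move=> v vi; rewrite /upd /=.
  case: (eqVneq (v : nat) i) => [vE|vi'].
    have -> : v = Ordinal lt by apply: val_inj.
    by rewrite /c; case: (_ < _).
  by apply: r2; lia.
- by move=> s' [_ _ _ r2]; apply: hQ => v; exact: r2.
Qed.

End Phases.

(** * The main theorem *)

Lemma input_adj n (G : sgraph n) m (v w : 'I_n) :
  imem (input G m) 1 (v * n + w)%N = G v w.
Proof.
have -> : imem (input G m) 1 (v * n + w)%N =
  [exists u : 'I_n, exists z : 'I_n, ((v * n + w)%N == (u * n + z)%N) && G u z] :> nat by [].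
congr nat_of_bool; apply/existsP/idP => [[u /existsP[z /andP[/eqP e Guz]]]|Gvw]; last first.
  by exists v; apply/existsP; exists w; rewrite eqxx.
have n0 : (0 < n)%N by apply: leq_ltn_trans (ltn_ord v).
have -> : v = u.
  apply: val_inj; have := congr1 (fun x => x %/ n)%N e.
  by rewrite !divnMDl // !divn_small // !addn0.
have -> // : w = z.
apply: val_inj; have := congr1 (fun x => x %% n)%N e.
by rewrite !modnMDl !modn_small.
Qed.

(** A power of 128 n <= n^8 is a power of n, and ln m >= ln 2 turns a constant
    exponent into a multiple of ln m. *)
Lemma steps_le_power (R : realType) n m (c : prog) t (D : nat) :
  (1 < m)%N -> (m <= n)%N -> (degree c <= D)%N -> (t <= step_bound (128 * n) c)%N ->
  t%:R <= n%:R `^ ((8 * D)%:R / ln 2 * ln (m%:R : R)) :> R.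
Proof.
move=> m1 mn cD tle.
have n1 : (1 < n)%N by exact: leq_trans mn.
have n0 : (0 < n)%N by exact: ltnW.
have tn : (t <= n ^ (8 * D))%N.
  apply: leq_trans tle _; apply: leq_trans (step_bound_le _ _) _; first by lia.
  apply: leq_trans (_ : (n ^ 8) ^ degree c <= _)%N.
    case: (degree c) => [|d]; first by rewrite !expn0.
    by rewrite leq_exp2r // expnSr leq_mul2r (@leq_exp2r 2 n 7) // n1 orbT.
  by rewrite -expnM leq_exp2l // leq_mul2l cD orbT.
have ln2 : 0 < ln (2 : R) by rewrite ln_gt0 // ltr1n.
apply: le_trans (_ : (n ^ (8 * D))%:R <= _); first by rewrite ler_nat.
rewrite natrX -powR_mulrn ?ler0n //; apply: ler_powR; first by rewrite ler1n.
rewrite -[X in X <= _](divfK (lt0r_neq0 ln2)).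
apply: ler_wpM2l; first by rewrite divr_ge0 // ltW.
by rewrite ler_ln ?posrE ?ltr0n ?ler_nat // ltnW.
Qed.

Section Main.
Variables (R : realType) (g : rat) (n m : nat) (G : sgraph n).
Hypothesis m_gt1 : (1 < m)%N.
Hypothesis m_le_n : (m <= n)%N.
Hypothesis g_gt0 : 0 < g.
Hypothesis g_small : g / (m%:R - 1) * m%:R <= 1 / 5.
Let fl := (n < m + m)%N.
Let k := if fl then (n - m)%N else m.
Let B : rat := 2 * g / (m%:R - 1).
Hypothesis B_small : B * (`|k%:R - 1| + fl%:R * (n%:R - 1)) <= 9 / 25.

Let k_half : (2 * k <= n)%N.
Proof. rewrite /k /fl; case: ltnP; move: m_le_n; lia. Qed.

Let n_gt0 : (0 < n)%N. Proof. exact: leq_trans (ltnW m_gt1) m_le_n. Qed.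

Lemma prog_rounds : exists t s,
  [/\ run (dense_subset_prog g) (input G m) t s,
      (t <= step_bound (128 * n) (dense_subset_prog g))%N,
      #|output n s| = m &
      nonedges G (indic rat (output n s)) <= nonedges G (mf_marginal m G g fl)].
Proof.
have nL : (n <= 128 * n)%N by lia.
pose N := (128 * n)%N; have NL : (N <= 128 * n)%N by [].
pose good s := #|output n s| = m /\
   nonedges G (indic rat (output n s)) <= nonedges G (mf_marginal m G g fl).
suff [t [s [r tle [h1 h2]]]] : wp (128 * n) (dense_subset_prog g) (input G m) good.
  by exists t, s.
apply/wp_seq/wp_seq/wp_if.
apply: (@wp_weaken _ _ _ (fun s => s = seti (seti (input G m) 0 2 k) 0 3 fl)).
  rewrite [teval _ _]/= -/fl /k; case: fl => /=;
  by apply/wp_seq/wp_iset/wp_iset.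
move=> _ ->; apply/wp_seq/wp_iset/wp_qset.
set s0 := setq _ _ _ _.
have B0 : Base G k fl N B s0.
  by split=> // v w; rewrite -(input_adj G m).
apply/wp_seq/(uniform_spec nL NL B0) => s1 B1 r1.
apply/wp_seq/(mf_loop_spec nL NL B1 r1) => s2 B2 r2.
apply/wp_seq/(marginal_spec nL NL B2) => s3 B3 r3.
have r3E : row 3 s3 =1 mf_marginal m G g fl by move=> v; rewrite r3 r2.
have p01 (v : 'I_n) : 0 <= row 3 s3 v <= 1 by rewrite r3E; exact: mf_marginal_01.
have psum : \sum_(v < n) row 3 s3 v = m%:R.
  by rewrite (eq_bigr _ (fun v _ => r3E v)); exact: mf_marginal_sum.
apply/wp_seq/(rounding_spec nL NL B3 n_gt0 p01 psum) => s4 B4 int sum4 le4.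
apply: (output_spec nL NL B4) => s5 out.
have indE : indic rat (output n s5) =1 row 3 s4.
  move=> v; rewrite /indic inE out.
  by case/orP: (int v) => /eqP->.
split.
  apply/eqP; rewrite -(eqr_nat rat) -sum4 -(eq_bigr _ (fun v _ => indE v)).
  by rewrite -natr_sum -big_mkcond /= sum1_card.
rewrite /nonedges (eq_bil _ indE indE) -(eq_bil _ r3E r3E).
by apply: ler_wpM2l => //; rewrite invr_ge0.
Qed.

Lemma prog_finds D : (degree (dense_subset_prog g) <= D)%N ->
  finds_dense_subset (ratr g : R) ((8 * D)%:R / ln 2) (dense_subset_prog g) m G.
Proof.
move=> hD; have [t [s [r tle Sm hle]]] := prog_rounds.
exists t, s; split => //; first exact: steps_le_power tle.
set S := output n s in Sm hle *.
pose x : R := ratr g / (m%:R - 1).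
have g0 : 0 < ratr g :> R by rewrite ltr0q.
have xB : 2 * x = ratr B.
  by rewrite /B /x mulrA fmorph_div rmorphM /= ratr_nat rmorphB /= ratr_nat rmorph1.
have xs : x * m%:R <= 1 / 5.
  have := g_small; rewrite -(ler_rat R) rmorphM /= fmorph_div [X in _ <= X]fmorph_div /= rmorphB /=.
  by rewrite !ratr_nat rmorph1.
have x0 : 0 <= x by rewrite divr_ge0 ?(ltW g0) // subr_ge0 ler1n ltnW.
rewrite objectiveE // -/x.
have dens : 'C(n, m)%:R^-1 * Density (ratr g) m G <=
   expR (ratr g * m%:R + 64 / 100 - 2 * x * nonedges G (indic R S)).
  apply: le_trans (_ : 'C(n, m)%:R^-1 * (expR (ratr g * m%:R + 2 / 100) *
      \sum_(T : {set 'I_n} | #|T| == m) expR (- (2 * x * nonedges G (indic R T)))) <= _).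
    rewrite ler_wpM2l ?invr_ge0 // mulr_sumr; apply: ler_sum => T /eqP Tm.
    by rewrite -expRD; exact: weight_le.
  rewrite mulrCA xB.
  have avg := @subset_avg_le R n m G g fl m_gt1 m_le_n g_gt0 g_small B_small k_half.
  apply: le_trans (ler_wpM2l (expR_ge0 _) avg) _.
  rewrite -expRD ler_expR -/B -xB.
  have : 2 * x * nonedges G (indic R S) <= 2 * x * ratr (nonedges G (mf_marginal m G g fl)).
    apply: ler_wpM2l; first by rewrite mulr_ge0.
    have -> : nonedges G (indic R S) = ratr (nonedges G (indic rat S)).
      rewrite ratr_nonedges /nonedges; congr (_ * _).
      by apply: eq_bil => v; rewrite /indic ratr_nat.
    by rewrite ler_rat.
  lra.
rewrite -mulrA; apply: le_trans (ler_wpM2l _ dens) _; first by rewrite invr_ge0.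
have -> : ratr g * m%:R + 64 / 100 - 2 * x * nonedges G (indic R S) =
  64 / 100 + (ratr g * m%:R - 2 * x * nonedges G (indic R S)) by ring.
rewrite expRD mulrA ler_piMl ?expR_ge0 // mulrC ler_pdivrMr // mul1r.
exact: expR_le2.
Qed.

End Main.

Theorem mainTheorem5 (R : realType) :
  exists C : R,
    (exists p : prog, forall (n m : nat) (G : sgraph n),
       (1 < m <= n)%N ->
       finds_dense_subset (6%:R / 100%:R) C p m G)
    /\
    (exists p : prog, forall (n m : nat) (G : sgraph n),
       (1 < m <= n)%N -> (4 * m <= n)%N -> (10 <= m)%N ->
       finds_dense_subset (18%:R / 100%:R) C p m G).
Proof.
pose p1 := dense_subset_prog (6 / 100); pose p2 := dense_subset_prog (18 / 100).
exists ((8 * maxn (degree p1) (degree p2))%:R / ln 2); split.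
- exists p1 => n m G /andP[m1 mn].
  have -> : 6%:R / 100%:R = ratr (6 / 100) :> R by rewrite fmorph_div /= !ratr_nat.
  have m2 : 2 <= m%:R :> rat by rewrite ler_nat.
  have m1' : 0 < m%:R - 1 :> rat by lra.
  have mn' : m%:R <= n%:R :> rat by rewrite ler_nat.
  apply: (@prog_finds R (6 / 100) n m G m1 mn _ _ _ _ (leq_maxl _ _)).
  - lra.
  - rewrite mulrAC (ler_pdivrMr _ _ m1'); lra.
  - rewrite mulrAC (ler_pdivrMr _ _ m1').
  case: ltnP => h /=.
    have h' : n%:R + 1 <= m%:R + m%:R :> rat by rewrite -natrD natr1 ler_nat.
    have kb : `|(n - m)%:R - 1| <= m%:R - 1 :> rat.
      rewrite natrB // ler_norml; apply/andP; split; lra.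
    lra.
  rewrite ger0_norm; lra.
- exists p2 => n m G /andP[m1 mn] n4 m10.
  have -> : 18%:R / 100%:R = ratr (18 / 100) :> R by rewrite fmorph_div /= !ratr_nat.
  have m10' : 10 <= m%:R :> rat by rewrite ler_nat.
  have m1' : 0 < m%:R - 1 :> rat by lra.
  apply: (@prog_finds R (18 / 100) n m G m1 mn _ _ _ _ (leq_maxr _ _)).
  - lra.
  - rewrite mulrAC (ler_pdivrMr _ _ m1'); lra.
  rewrite mulrAC (ler_pdivrMr _ _ m1').
  case: ltnP => h /=; first by lia.
  rewrite ger0_norm; lra.
Qed.
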